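(* Let $\alpha\in(0,2)$ and let $d_1,\dots,d_r\ge1$ be integers. Given a finitely generated group $K$, let $$G=(\cdots(K\wr\mathbb{Z}^{d_1})\wr\cdots)\wr\mathbb{Z}^{d_r}\quad\text{and}\quad d=\sum_{i=1}^rd_i.$$ 1. If $K$ is finite, then $-\log\widetilde\Phi_{G,\rho_\alpha}(n)\simeq n^{d/(d+\alpha)}$. 2. If $K$ has polynomial volume growth, then $-\log\widetilde\Phi_{G,\rho_\alpha}(n)\simeq n^{d/(d+\alpha)}(\log n)^{\alpha/(d+\alpha)}$.
   Context: Notation $\simeq$: $f\simeq g$ means there are constants $c_1,\dots,c_4>0$ with $c_1f(c_2t)\le g(t)\le c_3f(c_4t)$ on the relevant real interval or on $\mathbb{N}$ (large $t$). The function $\widetilde\Phi_{G,\rho_\alpha}$: let $G$ be a finitely generated group with word length $|\cdot|$ relative to a fixed finite symmetric generating set, and $\rho_\alpha(x)=(1+|x|)^\alpha$. For a probability measure $\phi$ on $G$ put $W(\rho_\alpha,\phi)=\sup_{s>0}s\,\phi(\{x:\rho_\alpha(x)>s\})$. Fix a finite symmetric neighborhood $\Omega$ of $e$ and a constant $\kappa$, and let $\widetilde{\mathcal S}$ be the set of symmetric probability densities $\phi$ on $G$ with $\|\phi\|_\infty\le\kappa$ and $W(\rho_\alpha,\phi)\le\kappa\sup_{\Omega^2}\rho_\alpha$. Then $\widetilde\Phi_{G,\rho_\alpha}(n)=\inf\{\phi^{(2n)}(e):\phi\in\widetilde{\mathcal S}\}$, where $\phi^{(2n)}$ is the $2n$-fold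 convolution power. Up to $\simeq$ this does not depend on the choices of $\Omega$ and $\kappa$, which are dropped from the notation. Wreath product: for groups $K,H$, $K\wr H=K_H\rtimes_\tau H$, where $K_H$ is the group of finitely supported functions $f:H\to K$ (that is, $f(h)\neq e_K$ for only finitely many $h$) with pointwise multiplication and $(\tau_hf)(h')=f(h^{-1}h')$; product $(f,h)(f',h')=(f\cdot\tau_hf',hh')$. The group $G$ is built by iterating: start with $K_0=K$, and at step $i$ replace the current group $K_{i-1}$ by $K_i=K_{i-1}\wr\mathbb{Z}^{d_i}$; then $G=K_r$.
   Formalization: Part 1 assumes K nontrivial (for K trivial and r=1, G is Z^d and the claim fails) and part 2 assumes K infinite (a finite K also has polynomial growth, where part 1 contradicts part 2); κ is assumed such that the class of densities is nonempty. *)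

(* Defs.v *)
From HB Require Import structures.
From mathcomp Require Import all_boot all_order all_algebra finmap.
From mathcomp Require Import all_classical all_reals all_analysis.

Set Implicit Arguments.
Unset Strict Implicit.
Unset Printing Implicit Defensive.

Import Order.TTheory GRing.Theory Num.Theory.
Import numFieldNormedType.Exports.

Local Open Scope classical_set_scope.
Local Open Scope ring_scope.

(* The restricted direct product K_H, for a group K and a set H: pointwise
   multiplication on the finitely supported functions. *)
Section RestrictedProduct.
Local Open Scope group_scope.
Local Open Scope fset_scope.
Variables (K : groupType) (H : choiceType).

Definition restr_prod := {fsfun H -> K with (1 : K)}.
HB.instance Definition _ := Choice.on restr_prod.

Implicit Types f g : restr_prod.

Definition restr_one : restr_prod := [fsfun with (1 : K)].
Definition restr_mul f g : restr_prod :=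
  [fsfun x in finsupp f `|` finsupp g => f x * g x].
Definition restr_inv f : restr_prod := [fsfun x in finsupp f => (f x)^-1].

Lemma restr_oneE x : restr_one x = 1.
Proof. by rewrite fsfun0E. Qed.

Lemma restr_mulE f g x : restr_mul f g x = f x * g x.
Proof.
rewrite fsfunE inE; case: (finsuppP f x) => [_|_] //=.
by case: (finsuppP g x) => // _; rewrite mulg1.
Qed.

Lemma restr_invE f x : restr_inv f x = (f x)^-1.
Proof. by rewrite fsfunE; case: (finsuppP f x) => // _; rewrite invg1. Qed.

Lemma restr_mulA : associative restr_mul.
Proof. by move=> f g h; apply/fsfunP => x; rewrite !restr_mulE mulgA. Qed.
Lemma restr_mul1g : left_id restr_one restr_mul.
Proof. by move=> f; apply/fsfunP => x; rewrite restr_mulE restr_oneE mul1g. Qed.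
Lemma restr_mulg1 : right_id restr_one restr_mul.
Proof. by move=> f; apply/fsfunP => x; rewrite restr_mulE restr_oneE mulg1. Qed.
Lemma restr_mulVg : left_inverse restr_one restr_inv restr_mul.
Proof.
by move=> f; apply/fsfunP => x; rewrite restr_mulE restr_invE restr_oneE mulVg.
Qed.
Lemma restr_mulgV : right_inverse restr_one restr_inv restr_mul.
Proof.
by move=> f; apply/fsfunP => x; rewrite restr_mulE restr_invE restr_oneE mulgV.
Qed.

HB.instance Definition _ := isGroup.Build restr_prod
  restr_mulA restr_mul1g restr_mulg1 restr_mulVg restr_mulgV.

End RestrictedProduct.

Section WreathProduct.
Local Open Scope group_scope.
Local Open Scope fset_scope.
Variables K H : groupType.

Definition wr_shift (h : H) (f : restr_prod K H) : restr_prod K H :=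
  [fsfun x in [fset h * y | y in finsupp f] => f (h^-1 * x)].

Lemma wr_shiftE h f x : wr_shift h f x = f (h^-1 * x).
Proof.
rewrite fsfunE; case: ifPn => // /negP nin.
rewrite fsfun_dflt //; apply/negP => fx; apply: nin.
by apply/imfsetP; exists (h^-1 * x) => //=; rewrite mulgA mulgV mul1g.
Qed.

Definition wreath_type : Type := (restr_prod K H * H)%type.
HB.instance Definition _ := Choice.on wreath_type.

Implicit Types a b : wreath_type.

Definition wr_one : wreath_type := (1, 1).
Definition wr_mul a b : wreath_type := (a.1 * wr_shift a.2 b.1, a.2 * b.2).
Definition wr_inv a : wreath_type := (wr_shift a.2^-1 a.1^-1, a.2^-1).

Lemma restr_prodM (f g : restr_prod K H) x : (f * g) x = f x * g x.
Proof. exact: restr_mulE. Qed.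
Lemma restr_prodV (f : restr_prod K H) x : f^-1 x = (f x)^-1.
Proof. exact: restr_invE. Qed.
Lemma restr_prod1 x : (1 : restr_prod K H) x = 1.
Proof. exact: restr_oneE. Qed.

Let wrE := (restr_prodM, wr_shiftE, restr_prodV, restr_prod1).

Lemma wr_mulA : associative wr_mul.
Proof.
move=> [f h] [f' h'] [f'' h'']; congr (_, _); rewrite /= ?mulgA //.
by apply/fsfunP => x; rewrite !wrE /= invgM !mulgA.
Qed.
Lemma wr_mul1g : left_id wr_one wr_mul.
Proof.
move=> [f h]; congr (_, _); rewrite /= ?mul1g //.
by apply/fsfunP => x; rewrite !wrE /= invg1 mul1g.
Qed.
Lemma wr_mulg1 : right_id wr_one wr_mul.
Proof.
move=> [f h]; congr (_, _); rewrite /= ?mulg1 //.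
by apply/fsfunP => x; rewrite !wrE /= mulg1.
Qed.
Lemma wr_mulVg : left_inverse wr_one wr_inv wr_mul.
Proof.
move=> [f h]; congr (_, _); rewrite /= ?mulVg //.
by apply/fsfunP => x; rewrite !wrE /= mulVg.
Qed.
Lemma wr_mulgV : right_inverse wr_one wr_inv wr_mul.
Proof.
move=> [f h]; congr (_, _); rewrite /= ?mulgV //.
by apply/fsfunP => x; rewrite !wrE /= invgK mulgA mulgV mul1g mulgV.
Qed.

HB.instance Definition _ := isGroup.Build wreath_type
  wr_mulA wr_mul1g wr_mulg1 wr_mulVg wr_mulgV.

Definition wreath : groupType := wreath_type.

End WreathProduct.

Definition Zpow (d : nat) : groupType := Algebra.to_multiplicative 'rV[int]_d.

(* (...(K wr Z^d_1) wr ...) wr Z^d_r for ds = [:: d_1; ...; d_r] *)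
Definition iter_wreath (K : groupType) (ds : seq nat) : groupType :=
  foldl (fun L d => wreath L (Zpow d)) K ds.

Section WordLength.
Local Open Scope group_scope.
Local Open Scope fset_scope.
Variable G : groupType.
Implicit Types (S : {fset G}) (x : G) (n : nat).

Definition fset_mul (A B : {fset G}) : {fset G} :=
  [fset a * b | a in A, b in B].

Definition fset_exp S n : {fset G} := iter n (fset_mul S) [fset 1].

Definition fsymmetric S : Prop := forall x, x \in S -> x^-1 \in S.

Definition sym_generating S : Prop :=
  fsymmetric S /\ forall x, exists n, x \in fset_exp S n.

Definition finitely_generated : Prop := exists S, sym_generating S.

(* least n such that x is a product of n elements of S; the value 0 off the
   submonoid generated by S is never used *)
Definition word_length S x : nat :=
  if pselect (exists n, x \in fset_exp S n) is left xS then ex_minn xS else 0%N.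

Definition volume S n : nat :=
  #|` fset_set [set x | (word_length S x <= n)%N]%classic |.

Definition polynomial_growth : Prop :=
  exists2 S, sym_generating S &
    exists C D : nat, forall n, (0 < n)%N -> (volume S n <= C * n ^ D)%N.

End WordLength.

Section ReturnProbability.
Variables (R : realType) (G : groupType).
Implicit Types (phi psi rho : G -> R).

(* densities are with respect to the counting measure of G *)
Definition sym_density phi : Prop :=
  [/\ forall x, 0 <= phi x, forall x, phi (x^-1)%g = phi x &
      \esum_(x in [set: G]) (phi x)%:E = 1%E].

(* All the convolutions below are of nonnegative functions: esum is only
   meaningful for those. *)
Definition conv phi psi : G -> R := fun x =>
  fine (\esum_(y in [set: G]) (phi y * psi (y^-1 * x)%g)%:E).

Definition conv_pow phi n : G -> R :=
  iter n (conv phi) (fun x => (x == 1%g)%:R).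

Definition weak_moment rho phi : \bar R :=
  ereal_sup [set (s%:E * \esum_(x in [set x | (s < rho x)%R]) (phi x)%:E)%E
            | s in [set s : R | 0 < s]].

Definition sup_norm phi : \bar R :=
  ereal_sup [set `|phi x|%:E | x in [set: G]].

Definition spread_class rho (Omega : {fset G}) (kappa : R) : set (G -> R) :=
  [set phi | [/\ sym_density phi, (sup_norm phi <= kappa%:E)%E &
     (weak_moment rho phi <=
        (kappa * sup (rho @` [set` fset_mul Omega Omega]))%:E)%E]].

Definition Phi_tilde rho (Omega : {fset G}) (kappa : R) (n : nat) : R :=
  inf [set conv_pow phi n.*2 1%g | phi in spread_class rho Omega kappa].

Definition rho_pow (S : {fset G}) (alpha : R) (x : G) : R :=
  (1 + (word_length S x)%:R) `^ alpha.

End ReturnProbability.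

Definition simeq (R : realType) (f g : R -> R) : Prop :=
  exists c1 c2 c3 c4 : R,
    [/\ 0 < c1, 0 < c2, 0 < c3 & 0 < c4] /\
    \forall t \near +oo, c1 * f (c2 * t) <= g t <= c3 * f (c4 * t).

(* A function on nat is compared by simeq through its extension to the reals
   by integer parts, so that rescaling the argument by a real makes sense. *)
Definition on_reals (R : realType) (u : nat -> R) : R -> R :=
  fun t => u (Num.truncn t).

(* Main.v *)
Require Import Defs.
From HB Require Import structures.
From mathcomp Require Import all_boot all_order all_algebra finmap.
From mathcomp Require Import all_classical all_reals all_analysis.
From mathcomp Require Import zify ring lra.

Set Implicit Arguments.
Unset Strict Implicit.
Unset Printing Implicit Defensive.

Import Order.TTheory GRing.Theory Num.Theory.
Import numFieldNormedType.Exports.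

Local Open Scope classical_set_scope.
Local Open Scope ring_scope.

(** Both bounds come from functions on [G] at a scale [r], to be optimized at the end.
Write [d] for the sum of the [d_i], and [lam r] for 1 if [K] is finite, for [ln r] if
[K] is infinite of polynomial growth: [r ^ d * lam r] is the logarithm of the number
of lamp configurations that can be built within distance [r]. The two exponents in the
theorem come from the balance [n * r ^ - alpha = r ^ d * lam r].

Lower bound on return probabilities. For a symmetric density [phi] and a nonnegative
[f] of finite support [X], the form [<f, phi * f>] is compared with the return
probability by iterating the Cauchy-Schwarz inequality along the powers of 2
([corr_le_return]): if [<f, phi * f> >= (1 - x) |f| ^ 2] then [2 n] steps return with
probability at least about [exp (- 4 n x) / #|X|]. On [G] there are functions with
[ln #|X| = O(r ^ d * lam r)] that a step of length [l] moves by at most [O(l / r)] in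
relative norm: on a wreath product one takes a product of functions of the lamps,
times a tent function of the position ([wreath_test_family]); a generator changes only
one factor, so nothing is lost when the number of lamps grows. The weak moment of
order [alpha < 2] then gives [x = O(r ^ - alpha)] ([corr_density_ge]), for all the
densities of the class at once.

Upper bound. Since the infimum is taken at fixed [n], the density may depend on the
scale. For each of the [r ^ d] points [z] of a box, an element of [K] can be put in the
lamp at [z] by a word of length [O(r)]; this gives independent copies of [K] in [G]
([iter_wreath_has_copies]). Let [psi] put a random element of [K], within distance [r],
in a random copy. The walk driven by [psi] is a product of [r ^ d] walks on [K], hence
returns with probability [exp (- c r ^ d * lam r)] after about [r ^ d * lam r] steps
([refresh_return]). By the same Cauchy-Schwarz argument, a function whose norms satisfy
[|f|_1 ^ 2 <= exp (c r ^ d * lam r) |f|_2 ^ 2] loses a fixed proportion of its norm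
under [psi]. Mixing [psi] into some density of the class with weight of order
[r ^ - alpha] keeps the weak moment bounded ([admissible_perturb]), and a Nash type
iteration ([return_decay]) bounds the return probability by the larger of
[exp (- c r ^ d * lam r)] and [exp (- c n r ^ - alpha)]. The only delicate point is that
the class may be as small as its being nonempty permits: some of its constraints may be
equalities for every density, so that the mass given to [psi] has to be taken from the
longest elements of the support and sent farther away. *)

(** * Sums over groups *)

Section Esum.
Variable R : realType.
Implicit Types T : choiceType.

Lemma le_esum_fin T (A : set T) (a b : T -> R) : (forall x, A x -> a x <= b x) ->
  (\esum_(x in A) (a x)%:E <= \esum_(x in A) (b x)%:E)%E.
Proof. by move=> ab; apply: le_esum => x Ax; rewrite lee_fin ab. Qed.

Lemma esum_le_fset T (X : {fset T}) (a : T -> R) (c : \bar R) :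
  (forall x, 0 <= a x) -> (\esum_(x in [set: T]) (a x)%:E <= c)%E ->
  ((\sum_(x <- X) a x)%:E <= c)%E.
Proof.
move=> a0; apply: le_trans; apply: esum_ge; exists [set` X].
  by split.
by rewrite -fsbig_seq ?fset_uniq// sumEFin.
Qed.

Lemma esum_fset_supp T (X : {fset T}) (A : set T) (a : T -> R) :
  (forall x, 0 <= a x) -> (forall x, x \notin X -> a x = 0) ->
  \esum_(x in A) (a x)%:E = (\sum_(x <- X | x \in A) a x)%:E.
Proof.
move=> a0 aX; rewrite big_mkcond/= esum_mkcond.
have -> : (\esum_(i in [set: T]) (if i \in A then (a i)%:E else 0%R)
   = \esum_(i in [set` X]) (if i \in A then a i else 0)%:E)%E.
  rewrite [RHS]esum_mkcond; apply: eq_esum => x _; rewrite mem_setE.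
  by case: ifPn; case: ifPn => // xX _; rewrite aX.
rewrite esum_fset//; last by move=> x _; case: ifP => _; rewrite lee_fin.
by rewrite -fsbig_seq ?fset_uniq// sumEFin.
Qed.

Lemma esum_fset_suppT T (X : {fset T}) (a : T -> R) :
  (forall x, 0 <= a x) -> (forall x, x \notin X -> a x = 0) ->
  \esum_(x in [set: T]) (a x)%:E = (\sum_(x <- X) a x)%:E.
Proof.
move=> a0 aX; rewrite (esum_fset_supp _ a0 aX); congr _%:E.
by apply: eq_bigl => x; rewrite in_setT.
Qed.

Lemma exchange_esum T1 T2 (a : T1 -> T2 -> \bar R) :
  (forall x y, (0 <= a x y)%E) ->
  \esum_(x in [set: T1]) \esum_(y in [set: T2]) a x y =
  \esum_(y in [set: T2]) \esum_(x in [set: T1]) a x y.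
Proof.
move=> a0; rewrite !esum_esum//.
rewrite (reindex_esum ([set: T2] `*`` fun=> [set: T1]) _ (fun x => (x.2, x.1)))//.
split=> //=; first by move=> [x1 x2] [y1 y2] /= _ _ [-> ->].
by move=> [x y] _ /=; exists (y, x).
Qed.

Lemma reindex_esumT T1 T2 (e : T1 -> T2) (e' : T2 -> T1) (a : T2 -> \bar R) :
  cancel e e' -> cancel e' e ->
  \esum_(x in [set: T2]) a x = \esum_(x in [set: T1]) a (e x).
Proof.
move=> eK e'K; apply: reindex_esum; split => //=.
  by move=> x y _ _ /(congr1 e'); rewrite !eK.
by move=> x _; exists (e' x).
Qed.

Lemma esumZl T (A : set T) (c : R) (a : T -> R) : 0 <= c -> (forall x, 0 <= a x) ->
  (\esum_(x in A) (c * a x)%:E = c%:E * \esum_(x in A) (a x)%:E)%E.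
Proof.
move=> c0 a0; rewrite /esum -ereal_supZl//; last first.
  by apply/set0P; exists (\sum_(x \in set0) (a x)%:E)%E; exists set0; [exact: fsets_set0|].
congr ereal_sup; apply/seteqP.
have E X : finite_set X -> ((\sum_(x \in X) (c * a x)%:E) = c%:E * \sum_(x \in X) (a x)%:E)%E.
  by move=> fX; rewrite !fsbig_finite//= !sumEFin -EFinM mulr_sumr.
split => [_ [X [finX XA] <-]|_ [_ [X [finX XA] <-] <-]].
  exists (\sum_(x \in X) (a x)%:E)%E; first by exists X.
  by rewrite E.
by exists X => //; rewrite E.
Qed.

Section Group.
Variable G : groupType.
Local Open Scope group_scope.

Lemma esum_mulgl (g : G) (a : G -> \bar R) :
  \esum_(x in [set: G]) a (g * x) = \esum_(x in [set: G]) a x.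
Proof. by symmetry; apply: (reindex_esumT _ (mulKg g) (mulVKg g)). Qed.

Lemma esum_mulgr (g : G) (a : G -> \bar R) :
  \esum_(x in [set: G]) a (x * g) = \esum_(x in [set: G]) a x.
Proof. by symmetry; apply: (reindex_esumT _ (mulgK g) (mulgVK g)). Qed.

Lemma esum_invg (a : G -> \bar R) :
  \esum_(x in [set: G]) a x^-1 = \esum_(x in [set: G]) a x.
Proof. by symmetry; apply: (reindex_esumT _ (@invgK G) (@invgK G)). Qed.

End Group.
End Esum.

(** * Convolution powers *)

Section ConvPow.
Variables (R : realType) (G : groupType) (phi : G -> R).
Hypothesis phiD : sym_density phi.

Local Notation S n := (conv_pow phi n).

Lemma density_ge0 x : 0 <= phi x. Proof. by case: phiD. Qed.
Lemma density_sym x : phi (x^-1)%g = phi x. Proof. by case: phiD. Qed.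
Lemma density_mass : (\esum_(x in [set: G]) (phi x)%:E = 1)%E.
Proof. by case: phiD. Qed.
Hint Resolve density_ge0 : core.

Lemma conv_fin (f : G -> R) c x : (forall y, 0 <= f y <= c) ->
  (Defs.conv phi f x)%:E = (\esum_(y in [set: G]) (phi y * f (y^-1 * x)%g)%:E)%E.
Proof.
move=> f01; rewrite /Defs.conv fineK//.
have c0 : 0 <= c by have /andP[] := f01 1%g; exact: le_trans.
rewrite ge0_fin_numE; last first.
  by apply: esum_ge0 => y _; rewrite lee_fin mulr_ge0//; case/andP: (f01 (y^-1 * x)%g).
apply: (@le_lt_trans _ _ (c%:E * 1)%E); last by rewrite mule1 ltry.
rewrite -density_mass -esumZl//; apply: le_esum_fin => y _.
by rewrite mulrC ler_wpM2r//; case/andP: (f01 (y^-1 * x)%g).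
Qed.

Lemma conv_pow_props n : (forall x, 0 <= S n x) /\
  (\esum_(x in [set: G]) (S n x)%:E = 1)%E.
Proof.
elim: n => [|n [IH0 IH1]].
  split=> [x|]; first by rewrite /conv_pow/=.
  rewrite (@esum_fset_suppT _ _ [fset 1%g]%fset)//=; last first.
    by move=> x; rewrite inE => /negPf ->.
  by rewrite big_seq_fset1 eqxx.
have IH01 x : 0 <= S n x <= 1.
  rewrite IH0 -lee_fin -IH1; apply: esum_ge; exists [set x] => //.
  by rewrite fsbig_set1.
split=> [x|].
  rewrite -lee_fin [S _]/(Defs.conv phi (S n)) (conv_fin _ IH01).
  by apply: esum_ge0 => y _; rewrite lee_fin mulr_ge0.
under eq_esum => x _ do rewrite [S _]/(Defs.conv phi (S n)) (conv_fin _ IH01).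
rewrite exchange_esum; last by move=> x y; rewrite lee_fin mulr_ge0.
under eq_esum => y _.
  rewrite (esum_mulgl y^-1%g (fun x => (phi y * S n x)%:E)) esumZl// IH1 mule1.
  over.
exact: density_mass.
Qed.

Lemma conv_pow_ge0 n x : 0 <= S n x. Proof. exact: (conv_pow_props n).1. Qed.
Lemma conv_pow_mass n : (\esum_(x in [set: G]) (S n x)%:E = 1)%E.
Proof. exact: (conv_pow_props n).2. Qed.
Hint Resolve conv_pow_ge0 : core.

Lemma conv_pow_01 n x : 0 <= S n x <= 1.
Proof.
rewrite conv_pow_ge0 -lee_fin -(conv_pow_mass n); apply: esum_ge; exists [set x] => //.
by rewrite fsbig_set1.
Qed.

Lemma conv_pow0 x : S 0 x = (x == 1%g)%:R. Proof. by []. Qed.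

Lemma conv_powSE n x :
  (S n.+1 x)%:E = (\esum_(y in [set: G]) (phi y * S n (y^-1 * x)%g)%:E)%E.
Proof. by rewrite [S _]/(Defs.conv phi (S n)) (conv_fin _ (conv_pow_01 n)). Qed.

Lemma conv_powD m n x :
  (S (m + n) x)%:E = (\esum_(y in [set: G]) (S m y * S n (y^-1 * x)%g)%:E)%E.
Proof.
elim: m x => [|m IH] x.
  rewrite add0n (@esum_fset_suppT _ _ [fset 1%g]%fset); last 2 first.
  - by move=> y; rewrite mulr_ge0.
  - by move=> y; rewrite inE conv_pow0 => /negPf ->; rewrite mul0r.
  by rewrite big_seq_fset1 conv_pow0 eqxx mul1r invg1 mul1g.
have E y : (phi y * S (m + n) (y^-1 * x)%g)%:E =
  (\esum_(z in [set: G]) (phi y * (S m (y^-1 * z)%g * S n (z^-1 * x)%g))%:E)%E.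
  rewrite EFinM IH -esumZl//; last by move=> z; rewrite mulr_ge0.
  rewrite -(esum_mulgl y^-1%g).
  by apply: eq_esum => z _; rewrite invgM invgK -[(_ * _ * (_ * _))%g]mulgA mulVKg.
rewrite addSn conv_powSE.
under eq_esum => y _ do rewrite E.
rewrite exchange_esum; last by move=> y z; rewrite lee_fin !mulr_ge0.
apply: eq_esum => z _; rewrite mulrC EFinM conv_powSE -esumZl//; last first.
  by move=> y; rewrite mulr_ge0.
by apply: eq_esum => y _; congr _%:E; ring.
Qed.

Lemma conv_pow1 x : S 1 x = phi x.
Proof.
apply/EFin_inj; rewrite conv_powSE (@esum_fset_suppT _ _ [fset x]%fset).
- by rewrite big_seq_fset1 mulVg conv_pow0 eqxx mulr1.
- by move=> y; rewrite mulr_ge0.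
move=> y; rewrite inE conv_pow0 => yx; case: eqP => [/(congr1 (fun z => y * z)%g)|_]; last by rewrite mulr0.
by rewrite mulVKg mulg1 => xy; rewrite xy eqxx in yx.
Qed.

Lemma conv_powSr n x :
  (S n.+1 x)%:E = (\esum_(y in [set: G]) (S n y * phi (y^-1 * x)%g)%:E)%E.
Proof. by rewrite -addn1 conv_powD; apply: eq_esum => y _; rewrite conv_pow1. Qed.

Lemma conv_pow_sym n x : S n (x^-1)%g = S n x.
Proof.
elim: n x => [|n IH] x; first by rewrite !conv_pow0 invg_eq1.
apply/EFin_inj; rewrite conv_powSE conv_powSr.
rewrite -[RHS](esum_mulgl x); apply: eq_esum => y _.
by rewrite -invgM IH invgM -mulgA mulVg mulg1 density_sym mulrC.
Qed.

Lemma conv_powD_ge m n (X : {fset G}) x :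
  \sum_(y <- X) S m y * S n (y^-1 * x)%g <= S (m + n) x.
Proof.
rewrite -lee_fin; apply: esum_le_fset; last by rewrite conv_powD.
by move=> y; rewrite mulr_ge0.
Qed.

(** Two elements of l2 of equal norm have a scalar product at most the square of
this norm. *)
Lemma conv_pow_double_max n x : S n.*2 x <= S n.*2 1%g.
Proof.
have E y : S n.*2 y = S (n + n) y by rewrite addnn.
rewrite -(@ler_pM2l _ 2)// -lee_fin [leRHS]EFinM !E conv_powD -esumZl//; last first.
  by move=> y; rewrite mulr_ge0.
under [leRHS]eq_esum => y _ do rewrite mulg1 conv_pow_sym.
rewrite EFinM conv_powD -esumZl//; last by move=> y; rewrite mulr_ge0.
apply: (@le_trans _ _ (\esum_(y in [set: G]) (S n y * S n y)%:E +
   \esum_(y in [set: G]) (S n (y^-1 * x)%g * S n (y^-1 * x)%g)%:E)%E).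
  rewrite -esumD; try by move=> y _; rewrite lee_fin mulr_ge0.
  apply: le_esum_fin => y _.
  have := sqr_ge0 (S n y - S n (y^-1 * x)%g); nra.
rewrite -(esum_invg (fun y => (S n (y^-1 * x)%g * _)%:E))/=.
under [X in (_ + X)%E]eq_esum => y _ do rewrite invgK.
rewrite (esum_mulgr x (fun y => (S n y * S n y)%:E)).
rewrite -esumD; try by move=> y _; rewrite lee_fin mulr_ge0.
by apply: le_esum_fin => y _; rewrite mulrDl mul1r.
Qed.

Lemma conv_pow_double_decr n : S n.+1.*2 1%g <= S n.*2 1%g.
Proof.
rewrite doubleS -[_.+2]add2n -lee_fin conv_powD.
apply: (@le_trans _ _ (\esum_(y in [set: G]) (S n.*2 1%g * S 2 y)%:E)%E).
  by apply: le_esum_fin => y _; rewrite mulrC ler_wpM2r// conv_pow_double_max.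
by rewrite esumZl// conv_pow_mass mule1.
Qed.

Lemma conv_pow_double_homo m n : (m <= n)%N -> S n.*2 1%g <= S m.*2 1%g.
Proof.
by move=> /subnK <-; elim: (n - m)%N => // k; apply: le_trans; exact: conv_pow_double_decr.
Qed.

(** The part of the random walk that stays put at one of two consecutive steps
makes the two-step density dominate the one-step density. *)
Lemma conv_pow2_lazy z : z != 1%g -> 2 * phi 1%g * phi z <= S 2 z.
Proof.
move=> z1; have := conv_powD_ge 1 1 [fset 1%g; z]%fset z.
rewrite big_fsetU1 ?inE 1?eq_sym// big_seq_fset1 !conv_pow1 invg1 mul1g mulVg.
by rewrite [X in X <= _]/= => h; apply: le_trans h; lra.
Qed.

Lemma conv_pow_supp n (X : {fset G}) x : (forall y, y \notin X -> phi y = 0) ->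
  x \notin fset_exp X n -> S n x = 0.
Proof.
move=> phiX; elim: n x => [|n IH] x.
  by rewrite inE conv_pow0 => /negPf ->.
move=> xX; apply/EFin_inj; rewrite conv_powSE esum1// => y _.
have [yX|/phiX ->] := boolP (y \in X); last by rewrite mul0r.
rewrite IH ?mulr0//; apply: contra xX => yx; apply/imfset2P.
by exists y => //; exists (y^-1 * x)%g => //; rewrite mulVKg.
Qed.

End ConvPow.

(** * Spectral bounds on return probabilities *)

Lemma cauchy_schwarz_sum (R : realType) (T : Type) (X : seq T) (a b : T -> R) :
  (\sum_(x <- X) a x * b x) ^+ 2 <=
    (\sum_(x <- X) a x ^+ 2) * (\sum_(x <- X) b x ^+ 2).
Proof.
rewrite -subr_ge0 -(@pmulr_rge0 _ 2)//.
have -> : 2 * ((\sum_(x <- X) a x ^+ 2) * (\sum_(x <- X) b x ^+ 2)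
   - (\sum_(x <- X) a x * b x) ^+ 2) =
   \sum_(x <- X) \sum_(y <- X) (a x * b y - a y * b x) ^+ 2.
  under [RHS]eq_bigr => x _ do under eq_bigr => y _ do
    (rewrite (_ : _ ^+ 2 = a x ^+ 2 * b y ^+ 2 + b x ^+ 2 * a y ^+ 2
       - 2 * ((a x * b x) * (a y * b y))); last by ring).
  under [RHS]eq_bigr => x _ do rewrite sumrB big_split/= -!mulr_sumr.
  by rewrite sumrB big_split/= -mulr_sumr -!mulr_suml; ring.
by apply: sumr_ge0 => x _; apply: sumr_ge0 => y _; apply: sqr_ge0.
Qed.

Section Spectral.
Variables (R : realType) (G : groupType) (phi : G -> R).
Hypothesis phiD : sym_density phi.
Variables (f : G -> R) (X : {fset G}).
Hypothesis f0 : forall x, 0 <= f x.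

Local Notation S n := (conv_pow phi n).

(** The scalar product of [f] with its convolution by [psi], for [f] supported in [X]. *)
Definition corr (psi : G -> R) :=
  \sum_(x <- X) \sum_(y <- X) f x * f y * psi (x^-1 * y)%g.

Let S0 n x : 0 <= S n x. Proof. exact: conv_pow_ge0. Qed.

Lemma corr_ge0 n : 0 <= corr (S n).
Proof.
by apply: sumr_ge0 => x _; apply: sumr_ge0 => y _; rewrite !mulr_ge0.
Qed.

Lemma corr_le_double n :
  corr (S n) ^+ 2 <= (\sum_(x <- X) f x ^+ 2) * corr (S n.*2).
Proof.
pose v y := \sum_(x <- X) f x * S n (x^-1 * y)%g.
have -> : corr (S n) = \sum_(y <- X) f y * v y.
  rewrite /corr exchange_big/=; apply: eq_bigr => y _; rewrite mulr_sumr.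
  by apply: eq_bigr => x _; ring.
apply: le_trans (cauchy_schwarz_sum _ _ _) _.
rewrite ler_wpM2l ?sumr_ge0// => [x _|]; first exact: sqr_ge0.
have -> : \sum_(y <- X) v y ^+ 2 = \sum_(x <- X) \sum_(z <- X)
    f x * f z * \sum_(y <- X) S n (x^-1 * y)%g * S n (z^-1 * y)%g.
  under eq_bigr => y _ do rewrite expr2 mulr_suml.
  rewrite exchange_big/=; apply: eq_bigr => x _.
  under eq_bigr => y _ do rewrite mulr_sumr.
  rewrite exchange_big/=; apply: eq_bigr => z _.
  by rewrite mulr_sumr; apply: eq_bigr => y _; ring.
apply: ler_sum => x _; apply: ler_sum => z _; rewrite ler_wpM2l ?mulr_ge0//.
rewrite -addnn.
have := conv_powD_ge phiD n n [fset (x^-1 * y)%g | y in X]%fset (x^-1 * z)%g.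
rewrite big_imfset/=; last by move=> ? ? _ _; exact: mulgI.
apply: le_trans; apply: ler_sum => y _.
rewrite ler_wpM2l// -[in leRHS](conv_pow_sym phiD) invgM [in leRHS]invgM !invgK.
by rewrite -mulgA mulVKg.
Qed.

(** Iterating the Cauchy-Schwarz inequality along the powers of 2 compares the
quadratic form of [phi] with the return probability, which bounds the form of the
convolution power from above. *)
Lemma corr_le_return k : (0 < k)%N ->
  corr phi ^+ (2 ^ k) <= S (2 ^ k) 1%g *
    (\sum_(x <- X) f x) ^+ 2 * (\sum_(x <- X) f x ^+ 2) ^+ (2 ^ k).-1.
Proof.
move=> k0; set N2 := \sum_(x <- X) f x ^+ 2.
have N20 : 0 <= N2 by apply: sumr_ge0 => x _; exact: sqr_ge0.
have H j : corr phi ^+ (2 ^ j) <= corr (S (2 ^ j)) * N2 ^+ (2 ^ j).-1.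
  elim: j => [|j IH].
    rewrite expn0 !expr1 expr0 mulr1 le_eqVlt; apply/orP; left; apply/eqP.
    by apply: eq_bigr => x _; apply: eq_bigr => y _; rewrite conv_pow1.
  rewrite expnS mulnC exprM.
  have c0 : 0 <= corr phi.
    by apply: sumr_ge0 => x _; apply: sumr_ge0 => y _; rewrite !mulr_ge0 ?(density_ge0 phiD).
  apply: (@le_trans _ _ ((corr (S (2 ^ j)) * N2 ^+ (2 ^ j).-1) ^+ 2)).
    by rewrite lerXn2r// nnegrE ?exprn_ge0// mulr_ge0 ?corr_ge0// exprn_ge0.
  rewrite exprMn -exprM.
  apply: (@le_trans _ _ ((N2 * corr (S (2 ^ j).*2)) * N2 ^+ ((2 ^ j).-1 * 2))).
    by rewrite ler_wpM2r ?exprn_ge0// corr_le_double.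
  rewrite -muln2 [(N2 * _)%R]mulrC -mulrA -exprS.
  suff -> : (((2 ^ j).-1 * 2).+1 = (2 ^ j * 2).-1)%N by [].
  by have := expn_gt0 2 j; lia.
apply: le_trans (H k) _; rewrite ler_wpM2r ?exprn_ge0//.
rewrite expr2 mulr_suml mulr_sumr; apply: ler_sum => x _.
rewrite mulr_sumr mulr_sumr; apply: ler_sum => y _.
rewrite [leRHS]mulrC ler_wpM2l ?mulr_ge0//.
by case: k k0 => // k _; rewrite expnS mul2n; exact: conv_pow_double_max.
Qed.

(** The form [corr psi] is a sum over the steps of [psi] of autocorrelations. *)
Lemma corr_ge (psi : G -> R) (Z : {fset G}) : (forall x, 0 <= psi x) ->
  (forall x, x \notin X -> f x = 0) ->
  \sum_(z <- Z) psi z * (\sum_(x <- X) f x * f (x * z)%g) <= corr psi.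
Proof.
move=> psi0 fX; under eq_bigr => z _ do rewrite mulr_sumr.
rewrite exchange_big/=; apply: ler_sum => x _.
under [leRHS]eq_bigr => y _ do rewrite -mulrA.
under [leLHS]eq_bigr => z _ do rewrite mulrCA.
rewrite -!mulr_sumr ler_wpM2l//.
have -> : \sum_(z <- Z) psi z * f (x * z)%g =
    \sum_(y <- [fset (x * z)%g | z in Z]%fset) psi (x^-1 * y)%g * f y.
  rewrite big_imfset/=; last by move=> ? ? _ _; exact: mulgI.
  by apply: eq_bigr => z _; rewrite mulKg.
under [leRHS]eq_bigr => y _ do rewrite mulrC.
rewrite -lee_fin -(@esum_fset_suppT _ _ X).
- by apply: esum_le_fset => // y; rewrite mulr_ge0.
- by move=> y; rewrite mulr_ge0.
- by move=> y /fX ->; rewrite mulr0.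
Qed.

End Spectral.

(** * Word length and balls *)

Section WordLength.
Local Open Scope group_scope.
Local Open Scope fset_scope.
Variables (G : groupType) (S : {fset G}).
Hypothesis hS : sym_generating S.

Local Notation wl := (word_length S).

Lemma word_length_mem x : x \in fset_exp S (wl x).
Proof.
rewrite /word_length; case: pselect => [xS|]; last by case; exact: hS.2.
by case: ex_minnP.
Qed.

Lemma word_length_min x n : x \in fset_exp S n -> (wl x <= n)%N.
Proof.
move=> xn; rewrite /word_length; case: pselect => // xS.
by case: ex_minnP => m _; apply.
Qed.

Lemma fset_expD m n x y :
  x \in fset_exp S m -> y \in fset_exp S n -> x * y \in fset_exp S (m + n).
Proof.
elim: m x => [|m IH] x; first by rewrite inE => /eqP ->; rewrite mul1g.
move=> /imfset2P[s /= sS [z /= zm ->]] yn; rewrite -mulgA; apply/imfset2P.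
by exists s => //; exists (z * y) => //=; exact: IH.
Qed.

Lemma fset_expV n x : x \in fset_exp S n -> x^-1 \in fset_exp S n.
Proof.
elim: n x => [|n IH] x; first by rewrite inE => /eqP ->; rewrite invg1 inE.
move=> /imfset2P[s /= sS [z /= zm ->]]; rewrite invgM -[fset_mul S _]/(fset_exp S n.+1) -addn1.
apply: fset_expD; first exact: IH.
apply/imfset2P; exists s^-1; first exact: hS.1.
by exists 1; rewrite ?mulg1//= inE.
Qed.

Lemma word_length1 : wl 1 = 0%N.
Proof. by apply/eqP; rewrite -leqn0; apply: word_length_min; rewrite inE. Qed.

Lemma word_lengthM x y : (wl (x * y) <= wl x + wl y)%N.
Proof. by apply: word_length_min; apply: fset_expD; exact: word_length_mem. Qed.

Lemma word_lengthV x : wl x^-1 = wl x.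
Proof.
have le y : (wl y^-1 <= wl y)%N.
  by apply: word_length_min; apply: fset_expV; exact: word_length_mem.
by apply/eqP; rewrite eqn_leq le -{1}[x]invgK le.
Qed.

Definition word_ball n : {fset G} :=
  [fset x in \bigcup_(k <- iota 0 n.+1) fset_exp S k | (wl x <= n)%N].

Lemma word_ballP n x : (x \in word_ball n) = (wl x <= n)%N.
Proof.
rewrite !inE. rewrite andb_idl// => xn; apply/bigfcupP; exists (wl x).
  by rewrite andbT mem_iota add0n ltnS xn.
exact: word_length_mem.
Qed.

Lemma volumeE n : volume S n = #|` word_ball n|.
Proof.
rewrite /volume; suff -> : [set x | (wl x <= n)%N] = [set` word_ball n]%classic.
  by rewrite set_fsetK.
by apply/seteqP; split => x /=; rewrite word_ballP.
Qed.

(** Finitely many values on the generators control a length along any word. *)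
Lemma length_le_word_length (l : G -> nat) :
  (forall x y, l (x * y)%g <= l x + l y)%N -> l 1 = 0%N ->
  exists C, forall x, (l x <= C * wl x)%N.
Proof.
move=> lM l1; exists (\max_(s <- S) l s)%N => x0.
suff H n x : x \in fset_exp S n -> (l x <= (\max_(s <- S) l s) * n)%N.
  by apply: (H _ _ (word_length_mem x0)).
elim: n x => [|n IH] x; first by rewrite inE => /eqP ->; rewrite l1.
move=> /imfset2P[s /= sS [z /= zm ->]]; apply: leq_trans (lM _ _) _.
by rewrite mulnS leq_add ?IH//; exact: leq_bigmax_seq.
Qed.

(** If two consecutive balls coincide, the ball is stable under the generators. *)
Lemma word_ball_card n : infinite_set [set: G] -> (n < #|` word_ball n|)%N.
Proof.
move=> Ginf; have sub m k : (m <= k)%N -> word_ball m `<=` word_ball k.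
  by move=> mk; apply/fsubsetP => x; rewrite !word_ballP => /leq_trans; apply.
elim: n => [|n IH].
  by rewrite cardfs_gt0; apply/fset0Pn; exists 1; rewrite word_ballP word_length1.
apply: leq_ltn_trans IH _; apply: fproper_ltn_card.
rewrite fproperEneq sub// andbT; apply: contra_notN Ginf => /eqP E.
suff -> : [set: G]%classic = [set` word_ball n]%classic by exact: finite_fset.
apply/seteqP; split => // x0 _ /=.
suff H m x : x \in fset_exp S m -> x \in word_ball n.
  by apply: (H _ _ (word_length_mem x0)).
elim: m x => [|m IHm] x.
  by rewrite inE => /eqP ->; rewrite word_ballP word_length1.
move=> /imfset2P[s /= sS [z /= /IHm]]; rewrite word_ballP => zn ->.
rewrite E word_ballP -[n.+1]add1n; apply: leq_trans (word_lengthM _ _) _.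
rewrite leq_add//; apply: word_length_min; apply/imfset2P; exists s => //.
by exists 1; rewrite ?mulg1//= inE.
Qed.

End WordLength.

(** * Almost invariant functions *)

Section Energy.
Variables (R : realType) (G : groupType).
Implicit Types (f : G -> R) (s t x : G).

Definition energy f s : \bar R :=
  \esum_(x in [set: G]) ((f (x * s)%g - f x) ^+ 2)%:E.

Definition norm2 f : \bar R := \esum_(x in [set: G]) (f x ^+ 2)%:E.

Lemma norm2_ge0 f : (0 <= norm2 f)%E.
Proof. by apply: esum_ge0 => x _; rewrite lee_fin sqr_ge0. Qed.

Lemma energy1 f : energy f 1%g = 0%E.
Proof. by apply: esum1 => x _; rewrite mulg1 subrr expr0n. Qed.

(** The parameter replaces a triangle inequality for square roots of energies: a good
[p] is the ratio of the square roots of the energies of [s] and [t]. *)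
Lemma energyM f s t (p : R) : 0 < p ->
  (energy f (s * t)%g <= (1 + p^-1)%:E * energy f s + (1 + p)%:E * energy f t)%E.
Proof.
move=> p0; have pV0 : 0 < p^-1 by rewrite invr_gt0.
rewrite -[energy f t](esum_mulgr s) /energy.
rewrite -!esumZl; try by move=> x; exact: sqr_ge0.
2,3: by rewrite addr_ge0// ltW.
rewrite -esumD; try by move=> x _; rewrite lee_fin mulr_ge0 ?sqr_ge0// addr_ge0// ltW.
apply: le_esum_fin => x _; rewrite mulgA.
set a := f (x * s * t)%g; set b := f (x * s)%g; set c := f x.
rewrite -subr_ge0; set E := (X in 0 <= X).
suff -> : E = p^-1 * ((b - c) - p * (a - b)) ^+ 2 by rewrite mulr_ge0 ?sqr_ge0// ltW.
by rewrite /E; field; rewrite gt_eqF.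
Qed.

(** The square root of the energy is subadditive, so it grows at most linearly along a
word. *)
Lemma energy_word_length (S : {fset G}) (c : R) f : sym_generating S -> 0 <= c ->
  (forall s, s \in S -> (energy f s <= c%:E)%E) ->
  forall x, (energy f x <= ((word_length S x)%:R ^+ 2 * c)%:E)%E.
Proof.
move=> hS c0 fS x0.
suff H n x : x \in fset_exp S n -> (energy f x <= (n%:R ^+ 2 * c)%:E)%E.
  by apply: H; exact: word_length_mem.
elim: n x => [|n IH] x; first by rewrite inE => /eqP ->; rewrite energy1 expr0n mul0r.
move=> /imfset2P[s /= sS [z /= zm ->]].
case: n IH zm => [|n] IH zm.
  move: zm; rewrite inE => /eqP ->; rewrite mulg1 expr1n mul1r; exact: fS.
(* the bounds for [s] and [z] are in the ratio 1 to [n.+1 ^ 2] *)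
apply: le_trans (@energyM f s z n.+1%:R^-1 _) _; first by rewrite invr_gt0.
rewrite invrK; apply: le_trans (leeD (lee_wpmul2l _ (fS _ sS)) (lee_wpmul2l _ (IH _ zm))) _.
- by rewrite lee_fin addr_ge0.
- by rewrite lee_fin addr_ge0// invr_ge0.
rewrite -!EFinM -EFinD lee_fin le_eqVlt; apply/orP; left; apply/eqP.
have : n.+1%:R != 0 :> R by rewrite pnatr_eq0.
by rewrite -[n.+2]addn1 natrD; move: n.+1%:R => m m0; field.
Qed.

(** By invariance of the norm, the energy is twice the difference between the squared
norm of [f] and its autocorrelation at [s]. *)
Lemma autocorr_ge f (X : {fset G}) s (c : R) : (forall x, 0 <= f x) ->
  (forall x, x \notin X -> f x = 0) -> (energy f s <= c%:E)%E ->
  \sum_(x <- X) f x ^+ 2 - c / 2 <= \sum_(x <- X) f x * f (x * s)%g.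
Proof.
move=> f0 fX fc.
have E : (\esum_(x in [set: G]) (f x * f (x * s)%g)%:E + 2^-1%:E * energy f s =
   (\sum_(x <- X) f x ^+ 2)%:E)%E.
  rewrite -esumZl; try by move=> x; exact: sqr_ge0.
  2: by rewrite invr_ge0.
  rewrite -esumD; try by move=> x _; rewrite lee_fin mulr_ge0 ?sqr_ge0.
  transitivity (\esum_(x in [set: G]) (2^-1 * f x ^+ 2)%:E +
     \esum_(x in [set: G]) (2^-1 * f (x * s)%g ^+ 2)%:E)%E.
    rewrite -esumD; try by move=> x _; rewrite lee_fin mulr_ge0 ?sqr_ge0// invr_ge0.
    by apply: eq_esum => x _; rewrite -!EFinD; congr _%:E; field.
  rewrite (esum_mulgr s (fun x => (2^-1 * f x ^+ 2)%:E)).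
  rewrite -esumD; try by move=> x _; rewrite lee_fin mulr_ge0 ?sqr_ge0// invr_ge0.
  rewrite -(@esum_fset_suppT _ _ X)//.
  - by apply: eq_esum => x _; rewrite -!EFinD; congr _%:E; field.
  - by move=> x; exact: sqr_ge0.
  - by move=> x /fX ->; rewrite expr0n.
rewrite lerBlDr -lee_fin -E (@esum_fset_suppT _ _ X); last 2 first.
- by move=> x; rewrite mulr_ge0.
- by move=> x /fX ->; rewrite mul0r.
rewrite EFinD leeD2l// mulrC EFinM.
by apply: lee_wpmul2l => //; rewrite lee_fin invr_ge0.
Qed.

Definition tent (l : G -> nat) (n : nat) (x : G) : R := (n.*2 - l x)%N%:R.

(** A tent function of height [2 * n] has slope one, and the set where its value
is at least [n] carries a definite part of its support. *)
Lemma tent_energy (l : G -> nat) (B B' : {fset G}) (n : nat) (A : R) s :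
  (forall x y, l (x * y)%g <= l x + l y)%N -> (forall x, l (x^-1)%g = l x) ->
  (0 < n)%N -> (forall x, (x \in B) = (l x <= n)%N) ->
  (forall x, (x \in B') = (l x <= n.*2)%N) -> #|` B'|%:R <= A * #|` B|%:R ->
  0 <= A ->
  (energy (tent l n) s <=
     (2 * (l s)%:R ^+ 2 * A / n%:R ^+ 2)%:E * norm2 (tent l n))%E.
Proof.
move=> lM lV n0 BE B'E AB A0; set f := tent l n; have n0R : 0 < n%:R :> R by rewrite ltr0n.
have lB x : `|f (x * s)%g - f x| <= (l s)%:R.
  have := lM x s; have := lM (x * s)%g (s^-1)%g; rewrite mulgK lV => h1 h2.
  rewrite /f /tent; case: (leqP (l x) (l (x * s)%g)) => h.
    rewrite distrC ger0_norm ?subr_ge0 ?ler_nat ?leq_sub2l//.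
    by rewrite lerBlDr -natrD ler_nat; lia.
  rewrite ger0_norm ?subr_ge0 ?ler_nat ?leq_sub2l ?(ltnW h)//.
  by rewrite lerBlDr -natrD ler_nat; lia.
have f0 x : x \notin B' -> f x = 0.
  rewrite B'E -ltnNge => h; rewrite /f /tent.
  by have /eqP -> : (n.*2 - l x == 0)%N by rewrite subn_eq0 ltnW.
apply: (@le_trans _ _ (2 * (l s)%:R ^+ 2 * #|` B'|%:R)%:E).
  pose i x : R := (x \in B')%:R * (l s)%:R ^+ 2.
  have i0 x : 0 <= i x by rewrite mulr_ge0 ?sqr_ge0.
  have iE : \esum_(x in [set: G]) (i x)%:E = ((l s)%:R ^+ 2 * #|` B'|%:R)%:E.
    rewrite (@esum_fset_suppT _ _ B')//; last by move=> x /negPf; rewrite /i => ->; rewrite mul0r.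
    rewrite big_seq (eq_bigr (fun=> (l s)%:R ^+ 2)) => [|x]; last by rewrite /i => ->; rewrite mul1r.
    by rewrite -big_seq big_const_seq count_predT iter_addr_0 mulr_natr.
  rewrite -mulrA EFinM mulr2n EFinD muleDl// mul1e -{1}iE -(esum_mulgr s) -iE.
  rewrite -esumD; try by move=> x _; rewrite lee_fin.
  apply: le_esum_fin => x _; rewrite /i.
  have sq : (f (x * s)%g - f x) ^+ 2 <= (l s)%:R ^+ 2.
    by rewrite -real_normK ?num_real// lerXn2r ?nnegrE.
  have [h|/f0 h] := boolP (_ \in B'); have [h'|/f0 h'] := boolP (_ \in B').
  - by rewrite !mul1r (le_trans sq)// lerDl sqr_ge0.
  - by rewrite mul1r mul0r addr0.
  - by rewrite mul1r mul0r add0r.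
  - by rewrite h h' subr0 expr0n !mul0r addr0.
apply: (@le_trans _ _ ((2 * (l s)%:R ^+ 2 * A / n%:R ^+ 2)%:E * (n%:R ^+ 2 * #|`B|%:R)%:E)%E).
  rewrite -EFinM lee_fin; set c := 2 * _.
  have -> : c * A / n%:R ^+ 2 * (n%:R ^+ 2 * #|` B|%:R) = c * (A * #|` B|%:R).
    by field; rewrite gt_eqF.
  by rewrite ler_wpM2l// mulr_ge0// sqr_ge0.
apply: lee_wpmul2l; first by rewrite lee_fin divr_ge0 ?mulr_ge0// sqr_ge0.
have -> : n%:R ^+ 2 * #|` B|%:R = \sum_(x <- B) n%:R ^+ 2 :> R.
  by rewrite big_const_seq count_predT iter_addr_0 mulr_natr.
apply: (@le_trans _ _ (\sum_(x <- B) f x ^+ 2)%:E).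
  rewrite lee_fin big_seq [leRHS]big_seq; apply: ler_sum => x.
  rewrite BE => xn; rewrite lerXn2r ?nnegrE// ler_nat; lia.
by apply: esum_le_fset => // x; exact: sqr_ge0.
Qed.

End Energy.

(** * Lamps in wreath products *)

Section Lamps.
Local Open Scope group_scope.
Local Open Scope fset_scope.
Variables L H : groupType.
Implicit Types (g : restr_prod L H) (x z h : H) (l : L).

Definition lamp z l : restr_prod L H := [fsfun y in [fset z] => l].

Lemma lampE z l y : lamp z l y = if y == z then l else 1.
Proof. by rewrite fsfunE inE. Qed.

Lemma lampM z l l' : lamp z (l * l') = lamp z l * lamp z l'.
Proof. by apply/fsfunP => y; rewrite restr_prodM !lampE; case: eqP; rewrite ?mulg1. Qed.

Definition at_lamp z l : wreath L H := (lamp z l, 1) : wreath_type L H.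
Definition at_base h : wreath L H := (1, h) : wreath_type L H.

Lemma at_lampM z l l' : at_lamp z (l * l') = at_lamp z l * at_lamp z l'.
Proof.
congr (_, _); last by rewrite /= mulg1.
apply/fsfunP => y; rewrite /= restr_prodM wr_shiftE invg1 mul1g !lampE.
by case: eqP; rewrite ?mulg1.
Qed.

Lemma at_baseM h h' : at_base (h * h') = at_base h * at_base h'.
Proof.
congr (_, _); apply/fsfunP => y.
by rewrite /= restr_prodM wr_shiftE !restr_prod1 mulg1.
Qed.

Lemma at_lamp1 z : at_lamp z 1 = 1.
Proof.
congr (_, _); apply/fsfunP => y; rewrite lampE restr_prod1.
by case: eqP.
Qed.

Lemma wr_shift_lamp x z l : wr_shift x (lamp z l) = lamp (x * z) l.
Proof.
apply/fsfunP => y; rewrite wr_shiftE !lampE.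
by rewrite (can2_eq (mulVKg x) (mulKg x)).
Qed.

(** The walker goes to [z], changes the lamp there and comes back. *)
Lemma at_baseJ z l : at_lamp z l = at_base z * at_lamp 1 l * at_base z^-1.
Proof.
congr (_, _); last by rewrite /= mulg1 mulgV.
apply/fsfunP => y; rewrite /= !restr_prodM wr_shift_lamp wr_shiftE !restr_prod1.
by rewrite mul1g !mulg1.
Qed.

Lemma restr_prod_split g z : g = lamp z (g z) * (lamp z (g z)^-1 * g).
Proof.
apply/fsfunP => y; rewrite !restr_prodM !lampE.
by case: eqP => [->|_]; rewrite ?mulVKg ?mul1g ?mulKVg.
Qed.

(** The induction removes the lamps of a configuration one at a time. *)
Lemma wreath_ind (P : wreath L H -> Prop) :
  (forall a b, P a -> P b -> P (a * b)) -> (forall l, P (at_lamp 1 l)) ->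
  (forall h, P (at_base h)) -> forall a, P a.
Proof.
move=> PM Pl Pb [g h].
have -> : (g, h) = ((g, 1) : wreath L H) * at_base h.
  congr (_, _); last by rewrite /= mul1g.
  by apply/fsfunP => y; rewrite /= restr_prodM wr_shiftE restr_prod1 mulg1.
apply: (PM) => //; move: g; suff gen n g : (#|` finsupp g| <= n)%N -> P (g, 1).
  by move=> g; apply: gen (leqnn _).
elim: n g => [|n IH] g.
  rewrite leqn0 cardfs_eq0 => /eqP g0; suff -> : g = 1 by exact: (Pb 1).
  by apply/fsfunP => y; rewrite restr_prod1 fsfun_dflt// g0 inE.
have [/cardfs0_eq g0 _|] := posnP #|` finsupp g|.
  by apply: IH; rewrite g0 cardfs0.
rewrite cardfs_gt0 => /fset0Pn[z zg] gn.
rewrite (restr_prod_split g z); set g' := lamp _ _ * g.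
have -> : (lamp z (g z) * g', 1) = at_lamp z (g z) * ((g', 1) : wreath L H).
  congr (_, _); last by rewrite /= mulg1.
  apply/fsfunP => y; rewrite /= !restr_prodM wr_shiftE invg1 mul1g.
  by rewrite [g' y]restr_prodM.
apply: (PM); first by rewrite at_baseJ; do !apply: (PM) => //.
apply: IH; rewrite -ltnS; apply: leq_trans gn; apply: fproper_ltn_card.
rewrite fproperE; apply/andP; split.
  apply/fsubsetP => y; rewrite !mem_finsupp restr_prodM lampE.
  by have [->|_] := eqVneq y z; rewrite ?mul1g// -mem_finsupp zg.
apply/fsubsetPn; exists z => //.
by rewrite mem_finsupp restr_prodM lampE eqxx mulVg eqxx.
Qed.

End Lamps.

(** * Almost invariant functions on wreath products *)

Section WreathTest.
Variables (R : realType) (L H : groupType).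
Variables (f : L -> R) (U : {fset L}) (psi : H -> R) (B : {fset H}).
Hypothesis f0 : forall x, 0 <= f x.
Hypothesis fU : forall x, x \notin U -> f x = 0.
Hypothesis psi0 : forall x, 0 <= psi x.
Hypothesis psiB : forall x, x \notin B -> psi x = 0.
Implicit Types (g : restr_prod L H) (a : wreath L H) (l : L) (h x z : H).

Definition lamp_test g : R :=
  (finsupp g `<=` B)%fset%:R * \prod_(z <- B) f (g z).

Definition wreath_test a : R := psi a.2 * lamp_test a.1.

Lemma lamp_test_ge0 g : 0 <= lamp_test g.
Proof. by rewrite mulr_ge0// prodr_ge0. Qed.

Lemma wreath_test_ge0 a : 0 <= wreath_test a.
Proof. by rewrite mulr_ge0// lamp_test_ge0. Qed.

Lemma wreath_test1_gt0 : 0 < f 1%g -> 0 < psi 1%g -> 0 < wreath_test 1%g.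
Proof.
move=> f1 psi1; rewrite mulr_gt0// mulr_gt0//.
  rewrite ltr0n lt0b; apply/fsubsetP => x.
  by rewrite mem_finsupp restr_prod1 eqxx.
by apply: prodr_gt0 => z _; rewrite restr_prod1.
Qed.

Lemma esum_wreath (A : wreath L H -> \bar R) : (forall a, (0 <= A a)%E) ->
  \esum_(a in [set: wreath L H]) A a =
  \esum_(x in [set: H]) \esum_(g in [set: restr_prod L H]) A (g, x).
Proof.
move=> A0; rewrite esum_esum//.
rewrite (reindex_esum ([set: H] `*`` fun=> [set: restr_prod L H]) _
  (fun p => (p.2, p.1) : wreath L H))//.
split=> //=; first by move=> [x1 g1] [x2 g2] /= _ _ [-> ->].
by move=> [g x] _ /=; exists (x, g).
Qed.

(** Fubini for the coordinate [z] against all the others. *)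
Lemma esum_lamp z (A : restr_prod L H -> \bar R) : (forall g, (0 <= A g)%E) ->
  \esum_(g in [set: restr_prod L H]) A g =
  \esum_(g in [set g : restr_prod L H | g z = 1%g]) \esum_(l in [set: L])
     A (g * lamp z l)%g.
Proof.
move=> A0; rewrite esum_esum//.
rewrite (reindex_esum
  ([set g : restr_prod L H | g z = 1%g] `*`` fun=> [set: L]) _
  (fun p => (p.1 * lamp z p.2)%g))//.
split=> //=.
  move=> [g1 l1] [g2 l2]; rewrite !inE/= => -[g1z _] [g2z _] E.
  have lE : l1 = l2.
    have /fsfunP/(_ z) := E.
    by rewrite !restr_prodM !lampE eqxx g1z g2z !mul1g.
  by move: E; rewrite lE => /mulIg ->.
move=> g _ /=; exists ((g * lamp z (g z)^-1)%g, g z) => /=.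
  by rewrite restr_prodM lampE eqxx mulgV.
by rewrite -mulgA -lampM mulVg; apply/fsfunP => y; rewrite restr_prodM lampE; case: eqP => _; rewrite mulg1.
Qed.

Lemma lamp_test_split z g l : z \in B -> g z = 1%g ->
  lamp_test (g * lamp z l)%g =
    (finsupp g `<=` B)%fset%:R * \prod_(y <- B | y != z) f (g y) * f l.
Proof.
move=> zB gz; rewrite /lamp_test (bigD1_seq z) ?fset_uniq//=.
have -> : (finsupp (g * lamp z l)%g `<=` B)%fset = (finsupp g `<=` B)%fset.
  apply/fsubsetP/fsubsetP => S y.
    have [-> //|yz] := eqVneq y z.
    by move=> yg; apply: S; rewrite mem_finsupp restr_prodM lampE (negPf yz) mulg1 -mem_finsupp.
  have [->//|yz] := eqVneq y z.
  by rewrite mem_finsupp restr_prodM lampE (negPf yz) mulg1 -mem_finsupp => /S.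
rewrite restr_prodM lampE eqxx gz mul1g [f l * _]mulrC mulrA; congr (_ * _ * _).
by apply: eq_bigr => y yz; rewrite restr_prodM lampE (negPf yz) mulg1.
Qed.

Lemma lamp_test_energy z l (c : R) : z \in B -> 0 <= c ->
  (energy f l <= c%:E * norm2 f)%E ->
  (energy lamp_test (lamp z l) <= c%:E * norm2 lamp_test)%E.
Proof.
move=> zB c0 fl; rewrite /energy /norm2 -esumZl//; last by move=> x; exact: sqr_ge0.
rewrite (esum_lamp z); last by move=> g; rewrite lee_fin sqr_ge0.
rewrite [leRHS](esum_lamp z); last by move=> g; rewrite lee_fin mulr_ge0 ?sqr_ge0.
apply: le_esum => g /= gz.
set r := (finsupp g `<=` B)%fset%:R * \prod_(y <- B | y != z) f (g y).
under eq_esum => l' _.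
  rewrite -mulgA -lampM !lamp_test_split// -/r -mulrBr exprMn.
  over.
under [leRHS]eq_esum => l' _.
  rewrite lamp_test_split// -/r exprMn mulrCA.
  over.
rewrite !esumZl//; try by [exact: sqr_ge0 | move=> ?; exact: sqr_ge0 | move=> ?; rewrite mulr_ge0 ?sqr_ge0].
by apply: lee_wpmul2l; rewrite ?lee_fin ?sqr_ge0.

Qed.

(** A switch only changes the lamp at the position [x] of the walker, and [psi] keeps [x]
in [B]. The other factors are the same on both sides of the inequality, so the relative
energy is that of [f] on [L], whatever the number of lamps. *)
Lemma wreath_test_lamp_energy l (c : R) : 0 <= c ->
  (energy f l <= c%:E * norm2 f)%E ->
  (energy wreath_test (at_lamp 1%g l) <= c%:E * norm2 wreath_test)%E.
Proof.
move=> c0 fl; rewrite /energy /norm2 -esumZl//; last by move=> x; exact: sqr_ge0.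
rewrite esum_wreath; last by move=> a; rewrite lee_fin sqr_ge0.
rewrite [leRHS]esum_wreath; last by move=> a; rewrite lee_fin mulr_ge0 ?sqr_ge0.
apply: le_esum => x _.
under eq_esum => g _.
  rewrite /wreath_test/= wr_shift_lamp !mulg1 -mulrBr exprMn.
  over.
under [leRHS]eq_esum => g _.
  rewrite /wreath_test/= exprMn mulrCA.
  over.
rewrite !esumZl//; try by [exact: sqr_ge0 | move=> ?; exact: sqr_ge0 | move=> ?; rewrite mulr_ge0 ?sqr_ge0].
have [xB|/psiB ->] := boolP (x \in B); last by rewrite expr0n !mul0e.
apply: lee_wpmul2l; rewrite ?lee_fin ?sqr_ge0//.
exact: lamp_test_energy.
Qed.

Lemma wreath_test_base_energy h (c : R) : 0 <= c ->
  (energy psi h <= c%:E * norm2 psi)%E ->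
  (energy wreath_test (at_base L h) <= c%:E * norm2 wreath_test)%E.
Proof.
move=> c0 fl; rewrite /energy /norm2 -esumZl//; last by move=> x; exact: sqr_ge0.
rewrite esum_wreath; last by move=> a; rewrite lee_fin sqr_ge0.
rewrite [leRHS]esum_wreath; last by move=> a; rewrite lee_fin mulr_ge0 ?sqr_ge0.
rewrite exchange_esum; last by move=> *; rewrite lee_fin sqr_ge0.
rewrite [leRHS]exchange_esum; last by move=> *; rewrite lee_fin mulr_ge0 ?sqr_ge0.
apply: le_esum => g _.
have E x : wr_shift x (1%g : restr_prod L H) = 1%g.
  by apply/fsfunP => y; rewrite wr_shiftE !restr_prod1.
under eq_esum => x _.
  rewrite /wreath_test/= E mulg1 -mulrBl exprMn mulrC.
  over.
under [leRHS]eq_esum => x _.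
  rewrite /wreath_test/= exprMn mulrA mulrC.
  over.
rewrite !esumZl//; try by [exact: sqr_ge0 | move=> ?; exact: sqr_ge0 | move=> ?; rewrite mulr_ge0 ?sqr_ge0].
by apply: lee_wpmul2l; rewrite ?lee_fin ?sqr_ge0.
Qed.

Lemma wreath_test_supp : exists2 U' : {fset wreath L H},
  (#|` U'| <= #|` U| ^ #|` B| * #|` B|)%N &
  forall a, a \notin U' -> wreath_test a = 0.
Proof.
pose mk (t : {ffun B -> U}) : restr_prod L H :=
  [fsfun z in B => if insub z is Some b then val (t b) else 1%g].
pose F (p : {ffun B -> U} * B) : wreath L H := (mk p.1, val p.2).
exists [fset F p | p in {: {ffun B -> U} * B}]%fset.
  apply: leq_trans (leq_imfset_card _ _ _) _.
  by rewrite -cardE card_prod card_ffun !cardfE.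
move=> [g x] gx; rewrite /wreath_test/=.
have [xB|/psiB ->] := boolP (x \in B); last by rewrite mul0r.
have [gB|/negPf gB] := boolP (finsupp g `<=` B)%fset; last first.
  by rewrite /lamp_test gB mul0r mulr0.
have [/allP gU|/allPn[z zB gz]] := boolP (all (fun z => g z \in U) B); last first.
  by rewrite /lamp_test (bigD1_seq z) ?fset_uniq//= (fU gz) mul0r !mulr0.
case/negP: gx; apply/imfsetP => /=.
exists ([ffun b : B => [` gU _ (valP b)]%fset], [` xB]%fset) => //.
congr (_, _); apply/fsfunP => z; rewrite fsfunE.
case: ifPn => [zB|zB]; last by rewrite fsfun_dflt//; apply: contra zB; exact: fsubsetP.
by case: insubP => [b _ <-|]; rewrite ?ffunE ?zB.
Qed.

End WreathTest.

(** * Families of almost invariant functions *)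

Section TestFamily.
Variable R : realType.

(** [expR (V r)] is a size at which almost invariance of order [1 / r] becomes possible.
The rate is asked of each element separately: the elements that satisfy it form a
subgroup, and no generating set has to be carried through wreath products. *)
Definition test_family (G : groupType) (V : nat -> R) : Prop :=
  exists (f : nat -> G -> R) (U : nat -> {fset G}),
    (forall r, (0 < r)%N -> [/\ forall x, 0 <= f r x, 0 < f r 1%g,
       forall x, x \notin U r -> f r x = 0 & #|` U r|%:R <= expR (V r)]) /\
    (forall s, exists2 C, 0 <= C & forall r, (0 < r)%N ->
       (energy (f r) s <= (C / r%:R ^+ 2)%:E * norm2 (f r))%E).

Lemma test_family_le (G : groupType) (V V' : nat -> R) :
  (forall r, (0 < r)%N -> V r <= V' r) -> test_family G V -> test_family G V'.
Proof.
move=> VV' [f [U [fU fE]]]; exists f, U; split => // r r0.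
have [? ? ? UV] := fU r r0; split => //.
by apply: le_trans UV _; rewrite ler_expR VV'.
Qed.

Lemma finite_test_family (K : groupType) : finite_set [set: K] ->
  test_family K (fun=> ln #|` fset_set [set: K]|%:R).
Proof.
move=> finK; exists (fun=> fun=> 1), (fun=> fset_set [set: K]); split => [r r0|s].
  split => // [x|]; first by rewrite in_fset_set// in_setT.
  rewrite lnK// posrE ltr0n cardfs_gt0; apply/fset0Pn; exists 1%g.
  by rewrite in_fset_set// in_setT.
exists 0 => // r r0; rewrite mul0r mul0e /energy esum1// => x _.
by rewrite subrr expr0n.
Qed.

(** The support is made of the configurations with values in [U r] on [B r], and of a
position in [B r]. *)
Lemma wreath_test_family (L H : groupType) (V W : nat -> R) :
  (forall r, 0 <= V r) -> test_family L V -> test_family H W ->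
  test_family (wreath L H) (fun r => expR (W r) * V r + W r).
Proof.
move=> V0 [f [U [fU fE]]] [psi [B [psiB psiE]]].
have ex r : exists U' : {fset wreath L H}, (0 < r)%N ->
    (#|` U'| <= #|` U r| ^ #|` B r| * #|` B r|)%N /\
    forall a, a \notin U' -> wreath_test (f r) (psi r) (B r) a = 0.
  have [r0|] := boolP (0 < r)%N; last by exists fset0.
  have [f0 _ fU0 _] := fU r r0; have [p0 _ pB0 _] := psiB r r0.
  have [U' U'1 U'2] := wreath_test_supp fU0 pB0.
  by exists U'.
have [U' U'P] := choice ex.
exists (fun r => wreath_test (f r) (psi r) (B r)), U'; split => [r r0|].
  have [f0 f1 fU0 fV] := fU r r0; have [p0 p1 pB0 pW] := psiB r r0.
  have [U'1 U'2] := U'P r r0; split => //.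
  - by move=> x; exact: wreath_test_ge0.
  - exact: wreath_test1_gt0.
  apply: (@le_trans _ _ (#|` U r| ^ #|` B r| * #|` B r|)%N%:R).
    by rewrite ler_nat.
  rewrite natrM natrX expRD ler_pM// ?exprn_ge0//.
  apply: (@le_trans _ _ (expR (V r) ^+ #|` B r|)).
    by rewrite lerXn2r// ?nnegrE// expR_ge0.
  by rewrite -expRM_natr ler_expR mulrC ler_wpM2r.
apply: wreath_ind => [a b [Ca Ca0 CaE] [Cb Cb0 CbE]|l|h].
- exists (2 * Ca + 2 * Cb) => [|r r0]; first by rewrite addr_ge0// mulr_ge0.
  apply: le_trans (energyM _ _ _ (@ltr01 R)) _.
  have -> : 1 + 1^-1 = 2 :> R by rewrite invr1.
  have r20 : 0 <= (r%:R ^+ 2)^-1 :> R by rewrite invr_ge0 sqr_ge0.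
  apply: (le_trans (leeD (lee_wpmul2l _ (CaE r r0)) (lee_wpmul2l _ (CbE r r0)))) => //.
  have [n0] := norm2_ge0 (wreath_test (f r) (psi r) (B r)).
  rewrite !muleA -ge0_muleDl -?EFinM ?lee_fin ?mulr_ge0//.
  by rewrite -EFinD; apply: lee_wpmul2r => //; rewrite lee_fin [leRHS]mulrDl -!mulrA.
- have [C C0 CE] := fE l; exists C => // r r0.
  have [f0 f1 fU0 fV] := fU r r0; have [p0 p1 pB0 pW] := psiB r r0.
  by apply: wreath_test_lamp_energy => //; [rewrite divr_ge0// sqr_ge0|exact: CE].
- have [C C0 CE] := psiE h; exists C => // r r0.
  by apply: wreath_test_base_energy => //; [rewrite divr_ge0// sqr_ge0|exact: CE].
Qed.

End TestFamily.

(** * Volume growth and lattices *)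

Lemma leq_expn2r (m n d : nat) : (m <= n)%N -> (m ^ d <= n ^ d)%N.
Proof. by move=> mn; elim: d => // d IH; rewrite !expnS leq_mul. Qed.

(** Otherwise, doubling the scale [log r] times starting from [r] would multiply the
volume by more than polynomial growth allows. *)
Lemma doubling_scale (v : nat -> nat) (C D r : nat) :
  (forall n, 0 < v n)%N -> (forall n, (0 < n)%N -> (v n <= C * n ^ D)%N) ->
  (0 < r)%N -> exists n, [/\ (r <= n)%N, (n <= r * r)%N &
    (v n.*2 <= C * 4 ^ D * v n)%N].
Proof.
move=> v0 vD r0; pose J := (trunc_log 2 r).+1.
have rJ : (r < 2 ^ J)%N by exact: trunc_log_ltn.
have Jr : (2 ^ J.-1 <= r)%N by exact: trunc_logP.
have C0 : (0 < C)%N by have := leq_trans (v0 1%N) (vD 1%N isT); rewrite muln_gt0 => /andP[].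
pose P j := (v (2 ^ j * r).*2 <= C * 4 ^ D * v (2 ^ j * r))%N.
have [/hasP[j]|/hasPn nP] := boolP (has P (iota 0 J)).
  rewrite mem_iota add0n => /andP[_ jJ] Pj; exists (2 ^ j * r)%N; split => //.
    by rewrite leq_pmull// expn_gt0.
  rewrite leq_mul2r; apply/orP; right; apply: leq_trans Jr.
  by rewrite leq_exp2l// -ltnS prednK.
have step j : (j < J)%N -> (C * 4 ^ D * v (2 ^ j * r) < v (2 ^ j.+1 * r))%N.
  move=> jJ; rewrite expnS -(mulnA 2) mul2n ltnNge; apply: (nP j).
  by rewrite mem_iota add0n.
have grow j : (j <= J)%N -> ((C * 4 ^ D) ^ j * v r <= v (2 ^ j * r))%N.
  elim: j => [|j IH jJ]; first by rewrite !expn0 !mul1n.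
  apply: leq_trans (ltnW (step j jJ)).
  by rewrite expnS -mulnA leq_mul2l IH ?orbT// ltnW.
have := leq_trans (step J.-1 (leqnn _)) (vD _ _).
rewrite muln_gt0 expn_gt0/= r0 => /(_ isT); rewrite ltnNge => /negP[].
apply: leq_trans (_ : (C * 4 ^ D) ^ J <= _)%N; last first.
  rewrite {1}/J expnS leq_mul2l (leq_trans _ (grow J.-1 _)) ?orbT//=.
    by rewrite leq_pmulr.
rewrite -/J [leqRHS]expnMn leq_mul//; first by rewrite -{1}[C]expn1 leq_pexp2l.
apply: (@leq_trans ((2 ^ J * 2 ^ J) ^ D)).
  by apply: leq_expn2r; rewrite leq_mul2l (ltnW rJ) orbT.
by rewrite -expnMn -!expnM mulnC.
Qed.

Section BaseFamilies.
Variable R : realType.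

(** A tent function at a doubling scale between [r] and [r ^ 2]: the larger scale only
improves the invariance, and the support remains polynomial in [r]. *)
Lemma growth_test_family (K : groupType) : polynomial_growth K ->
  exists2 c : R, 0 < c & test_family K (fun r => c * ln r.+1%:R).
Proof.
move=> [S hS [C [D vD]]].
have v0 n : (0 < #|` word_ball S n|)%N.
  by rewrite cardfs_gt0; apply/fset0Pn; exists 1%g; rewrite word_ballP// word_length1.
have vD' n : (0 < n)%N -> (#|` word_ball S n| <= C * n ^ D)%N.
  by move=> /vD; rewrite volumeE.
have C0 : (0 < C)%N by have := leq_trans (v0 1%N) (vD' 1%N isT); rewrite muln_gt0 => /andP[].
have ex r : exists n, (0 < r)%N -> [/\ (r <= n)%N, (n <= r * r)%N &
    (#|` word_ball S n.*2| <= C * 4 ^ D * #|` word_ball S n|)%N].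
  have [r0|] := boolP (0 < r)%N; last by exists 0%N.
  by have [n nP] := doubling_scale v0 vD' r0; exists n.
have [n nP] := choice ex.
pose l := word_length S.
have lM x y : (l (x * y)%g <= l x + l y)%N by exact: word_lengthM.
have lV x : l (x^-1)%g = l x by exact: word_lengthV.
have ln2 : 0 < ln 2 :> R by rewrite ln_gt0// ltr1n.
pose c : R := ln (C * 2 ^ D)%N%:R / ln 2 + D%:R * 2 + 1.
have c0 : 0 < c.
  rewrite ltr_wpDl// addr_ge0 ?mulr_ge0// ?invr_ge0 ?(ltW ln2)// ln_ge0//.
  by rewrite ler1n muln_gt0 C0 expn_gt0.
exists c => //; exists (fun r => tent R l (n r)), (fun r => word_ball S (n r).*2).
split=> [r r0|s].
  have [rn nr nv] := nP r r0; have n0 : (0 < n r)%N by exact: leq_trans rn.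
  split => [x||x|].
  - by rewrite ler0n.
  - by rewrite /tent /l word_length1 subn0 ltr0n double_gt0.
  - by rewrite word_ballP// -ltnNge => h; rewrite /tent /l (eqP (_ : _ - _ == 0)%N)// subn_eq0 ltnW.
  have r1 : 0 < r.+1%:R :> R by rewrite ltr0n.
  have r2 : ln 2 <= ln r.+1%:R :> R by rewrite ler_ln ?posrE// ler_nat.
  apply: (@le_trans _ _ ((C * 2 ^ D)%N%:R * (r.+1%:R ^+ 2) ^+ D)).
    rewrite -!natrX -natrM ler_nat; apply: leq_trans (vD' _ _) _.
      by rewrite double_gt0.
    rewrite -mulnA leq_mul2l -expnMn -mul2n; apply/orP; right.
    apply: leq_expn2r; rewrite leq_mul2l.
    by apply: leq_trans nr _; rewrite -mulnn leq_mul.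
  rewrite -exprM -[leLHS]lnK ?posrE ?mulr_gt0 ?exprn_gt0 ?ltr0n ?muln_gt0 ?C0 ?expn_gt0//.
  rewrite ler_expR lnM ?posrE ?exprn_gt0 ?ltr0n ?muln_gt0 ?C0 ?expn_gt0// lnXn//.
  rewrite /c !mulrDl mul1r -addrA lerD//.
    rewrite mulrAC ler_pdivlMr// ler_wpM2l// ln_ge0//.
    by rewrite ler1n muln_gt0 C0 expn_gt0.
  rewrite -[_ *+ (2 * D)]mulr_natl natrM [2 * _]mulrC.
  by rewrite lerDl ln_ge0// ler1n.
exists (2 * (l s)%:R ^+ 2 * (C * 4 ^ D)%N%:R); first by rewrite !mulr_ge0// sqr_ge0.
move=> r r0; have [rn nr nv] := nP r r0; have n0 : (0 < n r)%N by exact: leq_trans rn.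
apply: le_trans (@tent_energy R K l _ _ (n r) (C * 4 ^ D)%N%:R s lM lV n0
  (fun x => word_ballP hS _ _) (fun x => word_ballP hS _ _) _ _) _ => //.
  by rewrite -natrM ler_nat.
apply: lee_wpmul2r; first exact: norm2_ge0.
rewrite lee_fin ler_wpM2l// ?mulr_ge0// ?sqr_ge0//.
by rewrite lef_pV2 ?posrE ?exprn_gt0 ?ltr0n// lerXn2r ?nnegrE// ler_nat.
Qed.

Section Box.
Variable d : nat.
Implicit Types x y : Zpow d.

Definition coord x (i : 'I_d) : int := (x : 'rV[int]_d) ord0 i.

Definition of_coord (c : 'I_d -> int) : Zpow d := (\row_i c i : 'rV[int]_d).

Lemma coordE c i : coord (of_coord c) i = c i. Proof. by rewrite /coord mxE. Qed.

Lemma coordP x y : (forall i, coord x i = coord y i) -> x = y.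
Proof. by move=> xy; apply/rowP => i; exact: xy. Qed.

Lemma coordM x y i : coord (x * y)%g i = coord x i + coord y i.
Proof. by rewrite /coord mxE. Qed.

Lemma coordV x i : coord (x^-1)%g i = - coord x i.
Proof. by rewrite /coord mxE. Qed.

Definition sup_length x : nat := \max_i `|coord x i|%N.

Lemma sup_lengthP x n : reflect (forall i, (`|coord x i| <= n)%N) (sup_length x <= n)%N.
Proof. by apply: (iffP (bigmax_leqP _ _ _)) => h i //; exact: h. Qed.

Lemma sup_lengthM x y : (sup_length (x * y)%g <= sup_length x + sup_length y)%N.
Proof.
apply/sup_lengthP => i; rewrite coordM.
apply: (@leq_trans (`|coord x i| + `|coord y i|)%N); first by lia.
by rewrite leq_add//; [exact: (sup_lengthP x _ (leqnn _))|exact: (sup_lengthP y _ (leqnn _))].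
Qed.

Lemma sup_lengthV x : sup_length (x^-1)%g = sup_length x.
Proof. by apply: eq_bigr => i _; rewrite coordV abszN. Qed.

Lemma sup_length1 : sup_length 1%g = 0%N.
Proof.
apply/eqP; rewrite -leqn0; apply/sup_lengthP => i.
by rewrite /coord mxE.
Qed.

Definition box_point n (t : {ffun 'I_d -> 'I_(n.*2.+1)}) : Zpow d :=
  of_coord (fun i => (t i : nat)%:Z - n%:Z).

Lemma box_point_inj n : injective (@box_point n).
Proof.
move=> t t' E; apply/ffunP => i; apply/val_inj.
have := congr1 (coord^~ i) E; rewrite !coordE => /addIr.
by case.
Qed.

Definition box n : {fset Zpow d} :=
  [fset box_point t | t in {: {ffun 'I_d -> 'I_(n.*2.+1)}}]%fset.

Lemma card_box n : #|` box n| = (n.*2.+1 ^ d)%N.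
Proof.
rewrite card_imfset/=; last exact: box_point_inj.
by rewrite -cardE card_ffun !card_ord.
Qed.

Lemma boxP n x : (x \in box n) = (sup_length x <= n)%N.
Proof.
apply/idP/idP => [/imfsetP[t _ ->]|/sup_lengthP xn].
  apply/sup_lengthP => i; rewrite coordE; have := ltn_ord (t i).
  by move: (nat_of_ord (t i)) => m; lia.
apply/imfsetP => /=.
exists [ffun i => inord (absz (coord x i + n%:Z))] => //; apply: coordP => i.
rewrite coordE ffunE; have := xn i; move: (coord x i) => c cn.
rewrite inordK; first lia.
lia.
Qed.

End Box.

Lemma Zpow_test_family (d : nat) :
  test_family (Zpow d) (fun r => ln ((r.*2.*2.+1 ^ d)%N%:R : R)).
Proof.
exists (fun r => tent R (@sup_length d) r), (fun r => box d r.*2); split=> [r r0|s].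
  split=> [x||x|].
  - by rewrite ler0n.
  - by rewrite /tent sup_length1 subn0 ltr0n double_gt0.
  - by rewrite boxP -ltnNge => h; rewrite /tent (eqP (_ : _ - _ == 0)%N)// subn_eq0 ltnW.
  by rewrite card_box lnK// posrE ltr0n expn_gt0.
exists (2 * (sup_length s)%:R ^+ 2 * 2 ^+ d).
  by rewrite !mulr_ge0// ?sqr_ge0 ?exprn_ge0.
move=> r r0.
apply: le_trans (@tent_energy R _ _ (box d r) (box d r.*2) r (2 ^+ d) s (@sup_lengthM d)
  (@sup_lengthV d) r0 (@boxP d r) (@boxP d _) _ _) _ => //.
  rewrite !card_box -natrX -natrM ler_nat -expnMn.
  by apply: leq_expn2r; lia.
Qed.

(** The hypothesis [1 <= V r] lets the number of positions of the walker be absorbed in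
the number of configurations. *)
Lemma Zpow_wreath_test_family (L : groupType) (d : nat) (V : nat -> R) :
  (forall r, (0 < r)%N -> 1 <= V r) -> test_family L V ->
  test_family (wreath L (Zpow d)) (fun r => 2 * 5 ^+ d * r%:R ^+ d * V r).
Proof.
move=> V1 LV; pose V' r := Num.max 0 (V r).
have LV' : test_family L V'.
  by apply: test_family_le LV => r r0; rewrite le_max lexx orbT.
apply: test_family_le (wreath_test_family _ LV' (Zpow_test_family d)); last first.
  by move=> r; rewrite le_max lexx.
move=> r r0; have -> : V' r = V r by apply/max_idPr; exact: le_trans (V1 _ r0).
have N0 : 0 < (r.*2.*2.+1 ^ d)%N%:R :> R by rewrite ltr0n expn_gt0.
rewrite lnK ?posrE//; set N := _%:R in N0 *.
have NV : ln N <= N * V r.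
  apply: (@le_trans _ _ N); last by rewrite ler_peMr ?V1// ltW.
  exact: ltW (ln_sublinear N0).
apply: (@le_trans _ _ (2 * N * V r)).
  by rewrite -mulrA mulr_natl mulr2n lerD2l.
rewrite ler_wpM2r ?(le_trans ler01) ?V1// -mulrA ler_wpM2l// /N -!natrX -natrM ler_nat -expnMn.
by apply: leq_expn2r; lia.
Qed.

(** Each level with base Z^d raises the logarithm of the size of the support by a
factor of order [r ^ d], the number of lamps within distance [r]. *)
Lemma iter_wreath_test_family (K : groupType) (ds : seq nat) (V : nat -> R) :
  (forall r, (0 < r)%N -> 1 <= V r) -> test_family K V ->
  exists2 c : R, 0 < c & test_family (iter_wreath K ds)
    (fun r => c * (r%:R ^+ (\sum_(i <- ds) i)%N * V r)).
Proof.
elim: ds K V => [|d ds IH] K V V1 KV.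
  exists 1 => //; apply: test_family_le KV => r _.
  by rewrite big_nil expr0 !mul1r.
have V1' r : (0 < r)%N -> 1 <= 2 * 5 ^+ d * r%:R ^+ d * V r.
  move=> r0; rewrite -[leLHS]mulr1 ler_pM ?V1//.
  rewrite -[leLHS]mulr1 ler_pM ?exprn_ege1 ?ler1n//.
  by rewrite -[leLHS]mulr1 ler_pM ?exprn_ege1 ?ler1n.
have [c c0 H] := IH _ _ V1' (Zpow_wreath_test_family d V1 KV).
exists (c * (2 * 5 ^+ d)); first by rewrite !mulr_gt0// exprn_gt0.
apply: test_family_le H => r r0; rewrite big_cons exprD.
by rewrite le_eqVlt; apply/orP; left; apply/eqP; ring.
Qed.

End BaseFamilies.

(** * Lower bounds on return probabilities *)

Section PowR.
Variable R : realType.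
Implicit Types x a b p : R.

Lemma powRDp x a b : 0 < x -> x `^ (a + b) = x `^ a * x `^ b.
Proof. by move=> x0; rewrite powRD//; apply/implyP => _; rewrite gt_eqF. Qed.

Lemma ler_powR_base x y p : 0 <= p -> 0 <= x -> x <= y -> x `^ p <= y `^ p.
Proof.
by move=> p0 x0 xy; apply: ge0_ler_powR; rewrite ?nnegrE//; exact: le_trans xy.
Qed.

(** The sum is compared with the integral of a power; each step of the induction comes
down to [(1 - 1 / x) ^ p <= exp (- p / x) <= 1 - p / (4 x)]. *)
Lemma sum_powR_le p n : 0 < p <= 3 ->
  \sum_(0 <= j < n) j.+1%:R `^ (p - 1) <= 4 / p * n%:R `^ p.
Proof.
move=> /andP[p0 p3]; have p40 : 0 < 4 / p by rewrite divr_gt0.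
elim: n => [|n IH]; first by rewrite big_nil mulr_ge0 ?powR_ge0// ltW.
rewrite big_nat_recr//=; apply: le_trans (lerD IH (lexx _)) _.
have -> : n.+1%:R `^ (p - 1) = 4 / p * (p / 4 * n.+1%:R `^ (p - 1)).
  by field; rewrite gt_eqF.
rewrite -mulrDr ler_wpM2l ?(ltW p40)//.
set x : R := n.+1%:R; have x0 : 0 < x by rewrite ltr0n.
have x1 : 1 <= x by rewrite ler1n.
have px : x `^ (p - 1) = x `^ p / x by rewrite powRDp// powR_inv1// ltW.
have [->|n0] := posnP n.
  rewrite powR0 ?gt_eqF// add0r px mulrA ler_pdivrMr// mulrC ler_wpM2l ?powR_ge0//.
  by apply: le_trans x1; rewrite ler_pdivrMr//; lra.
have -> : n%:R = x * (1 - x^-1).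
  by rewrite mulrBr mulr1 divff ?gt_eqF// /x -natr1 addrK.
have y0 : 0 < 1 - x^-1 by rewrite subr_gt0 invf_lt1// ltr1n.
rewrite powRM ?(ltW x0) ?(ltW y0)// px mulrA [p / 4 * _]mulrC -mulrA -mulrDr.
rewrite -[leRHS]mulr1 ler_wpM2l ?powR_ge0//.
have lnx : ln (1 - x^-1) <= - x^-1.
  by rewrite le_ln1Dx// ltrN2 invf_lt1// ltr1n.
set y := p / x; have yE : p / 4 / x = y / 4 by rewrite /y; ring.
have y00 : 0 < y by rewrite divr_gt0.
have y3 : y <= 3 by rewrite ler_pdivrMr//; nra.
have le1 : (1 - x^-1) `^ p <= expR (- y).
  rewrite -[(1 - x^-1) `^ p]lnK ?posrE ?powR_gt0// ler_expR ln_powR /y -mulrN.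
  by rewrite ler_wpM2l// ltW.
have le2 : expR (- y) <= (1 + y)^-1.
  by rewrite expRN lef_pV2 ?posrE ?expR_gt0 ?expR_ge1Dx//; lra.
have le3 : (1 + y)^-1 <= 1 - y / 4.
  by rewrite -div1r ler_pdivrMr; nra.
by rewrite yE; lra.
Qed.

End PowR.

Section Tail.
Variables (R : realType) (G : groupType) (S : {fset G}).
Hypothesis hS : sym_generating S.
Implicit Types (phi : G -> R) (alpha M : R).

Definition tail_bound phi alpha M := forall k, (0 < k)%N ->
  (\esum_(x in [set x : G | (k <= word_length S x)%N]) (phi x)%:E
     <= (M * k%:R `^ (- alpha))%:E)%E.

Lemma weak_moment_tail phi alpha M : 0 < alpha ->
  (weak_moment (rho_pow S alpha) phi <= M%:E)%E -> tail_bound phi alpha M.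
Proof.
move=> a0 WM k k0; have k0R : 0 < k%:R :> R by rewrite ltr0n.
have ka : 0 < k%:R `^ alpha :> R by rewrite powR_gt0.
have -> : [set x : G | (k <= word_length S x)%N] =
    [set x | k%:R `^ alpha < rho_pow S alpha x].
  apply/seteqP; split => x /= kx; rewrite /rho_pow.
    rewrite gt0_ltr_powR// ?nnegrE ?addr_ge0//.
    by rewrite addrC natr1 ltr_nat.
  rewrite leqNgt; apply/negP => xk; move: kx; rewrite ltNge => /negP; apply.
  apply: ler_powR_base => //; first exact: ltW.
  by rewrite addrC natr1 ler_nat.
rewrite powRN mulrC EFinM lee_pdivlMl//.
by apply: le_trans WM; apply: ereal_sup_ubound; exists (k%:R `^ alpha).
Qed.

(** The square of the length is summed along the tails of [phi]; the sum is dominated by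
the scale [r] because [alpha < 2]. *)
Lemma second_moment_le phi alpha M r : 0 < alpha < 2 -> 0 <= M ->
  (forall x, 0 <= phi x) -> tail_bound phi alpha M ->
  \sum_(z <- word_ball S r) phi z * (word_length S z)%:R ^+ 2 <=
    8 / (2 - alpha) * M * r%:R `^ (2 - alpha).
Proof.
move=> /andP[a0 a2] M0 phi0 phiM.
pose wl := word_length S.
have sq z : z \in word_ball S r -> (wl z)%:R ^+ 2 =
    \sum_(0 <= j < r) (2 * j.+1%:R - 1) * (j < wl z)%N%:R :> R.
  rewrite word_ballP// => zr.
  rewrite (big_cat_nat (leq0n _) zr)/= [X in _ + X](_ : _ = 0) ?addr0; last first.
    by rewrite big_nat big1// => j /andP[jz _]; rewrite ltnNge jz mulr0.
  rewrite -/wl; elim: (wl z) {zr} => [|n IH]; first by rewrite big_nil expr0n.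
  rewrite big_nat_recr//= ltnSn mulr1 -natr1.
  have -> : \sum_(0 <= i < n) (2 * i.+1%:R - 1) * (i < n.+1)%N%:R =
     \sum_(0 <= j < n) (2 * j.+1%:R - 1) * (j < n)%N%:R :> R.
    by apply: eq_big_nat => i /andP[_ ni]; rewrite ltnS ni (ltnW ni).
  by rewrite -IH; ring.
rewrite big_seq (eq_bigr (fun z => \sum_(0 <= j < r)
   (2 * j.+1%:R - 1) * (phi z * (j < wl z)%N%:R))); last first.
  by move=> z zr; rewrite sq// mulr_sumr; apply: eq_bigr => j _; ring.
rewrite -big_seq exchange_big/=.
have -> : 8 / (2 - alpha) * M * r%:R `^ (2 - alpha) =
  2 * M * (4 / (2 - alpha) * r%:R `^ (2 - alpha)) by ring.
apply: (@le_trans _ _ (2 * M * \sum_(0 <= j < r) j.+1%:R `^ ((2 - alpha) - 1))); last first.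
  by rewrite ler_wpM2l ?mulr_ge0// sum_powR_le//; lra.
rewrite mulr_sumr; apply: ler_sum => j _; rewrite -mulr_sumr.
have j1 : 1 <= j.+1%:R :> R by rewrite ler1n.
have -> : 2 * M * j.+1%:R `^ (2 - alpha - 1) = (2 * j.+1%:R) * (M * j.+1%:R `^ (- alpha)).
  rewrite (_ : 2 - alpha - 1 = 1 + - alpha); last by ring.
  by rewrite powRDp ?ltr0n// powRr1//; ring.
apply: ler_pM; [lra| |lra|].
  by apply: sumr_ge0 => z _; rewrite mulr_ge0.
rewrite -lee_fin; apply: le_trans (phiM j.+1 isT).
rewrite esum_mkcond; under eq_esum => x _.
  rewrite (_ : (if _ then _ else _) = (phi x * (j < wl x)%N%:R)%:E); last first.
    case: ifPn => [/set_mem/= jx|/negP jx]; first by rewrite /wl jx mulr1.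
    rewrite (_ : (j < wl x)%N = false) ?mulr0//.
    by apply/negP => h; apply: jx; exact: mem_set.
  over.
by apply: esum_le_fset => // x; rewrite mulr_ge0.
Qed.

End Tail.

Section ReturnLower.
Variables (R : realType) (G : groupType) (S : {fset G}).
Hypothesis hS : sym_generating S.
Implicit Types (phi f : G -> R) (alpha M c : R).

Lemma mass_word_ball_ge phi alpha M r : sym_density phi -> 0 < alpha -> 0 <= M ->
  tail_bound S phi alpha M -> (0 < r)%N ->
  1 - M * r%:R `^ (- alpha) <= \sum_(z <- word_ball S r) phi z.
Proof.
move=> phiD a0 M0 phiM r0; rewrite lerBlDr -lee_fin -(density_mass phiD).
rewrite (esumID [set` word_ball S r]); last first.
  by move=> x _; rewrite lee_fin density_ge0.
rewrite !setTI EFinD leeD//.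
  rewrite esum_fset; first by rewrite -fsbig_seq ?fset_uniq// sumEFin.
    exact: finite_fset.
  by move=> x _; rewrite lee_fin density_ge0.
have -> : ~` [set` word_ball S r] = [set x | (r.+1 <= word_length S x)%N].
  apply/seteqP; split => x /=; rewrite word_ballP// ltnNge; first by move/negP.
  by move=> h; apply/negP.
have h := phiM r.+1 isT; apply: le_trans h _.
rewrite lee_fin ler_wpM2l// !powRN lef_pV2 ?posrE ?powR_gt0 ?ltr0n//.
by apply: ler_powR_base; rewrite ?(ltW a0)// ler_nat.
Qed.

(** Steps of length at most [r] move the function by [O(|z| / r)] in norm, and the
tail of [phi] controls both their mean square and the mass of longer steps. *)
Lemma corr_density_ge phi f (X : {fset G}) alpha M c r :
  sym_density phi -> 0 < alpha < 2 -> 0 <= M -> tail_bound S phi alpha M ->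
  (0 < r)%N -> 0 <= c -> (forall x, 0 <= f x) -> (forall x, x \notin X -> f x = 0) ->
  (forall s, s \in S -> (energy f s <= (c / r%:R ^+ 2 * \sum_(x <- X) f x ^+ 2)%:E)%E) ->
  (\sum_(x <- X) f x ^+ 2) *
    (1 - (M + 4 * c * M / (2 - alpha)) * r%:R `^ (- alpha)) <= corr f X phi.
Proof.
move=> phiD a02 M0 phiM r0 c0 f0 fX fE; have /andP[a0 a2] := a02.
set N2 := \sum_(x <- X) f x ^+ 2 in fE *.
have N20 : 0 <= N2 by apply: sumr_ge0 => x _; exact: sqr_ge0.
have r0R : 0 < r%:R :> R by rewrite ltr0n.
apply: le_trans (corr_ge f0 (word_ball S r) (density_ge0 phiD) fX).
pose e := c / r%:R ^+ 2 * N2.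
have e0 : 0 <= e by rewrite mulr_ge0// divr_ge0// sqr_ge0.
apply: (@le_trans _ _ (\sum_(z <- word_ball S r)
    phi z * (N2 - (word_length S z)%:R ^+ 2 * e / 2))); last first.
  apply: ler_sum => z _; rewrite ler_wpM2l ?density_ge0//.
  by apply: autocorr_ge => //; exact: energy_word_length.
have -> : \sum_(z <- word_ball S r) phi z * (N2 - (word_length S z)%:R ^+ 2 * e / 2) =
  N2 * (\sum_(z <- word_ball S r) phi z -
    c / r%:R ^+ 2 / 2 * \sum_(z <- word_ball S r) phi z * (word_length S z)%:R ^+ 2).
  rewrite mulrBr !mulr_sumr -sumrB; apply: eq_bigr => z _.
  by rewrite /e; ring.
rewrite ler_wpM2l// mulrDl opprD addrA lerB//.
  exact: mass_word_ball_ge phiD a0 M0 phiM r0.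
apply: le_trans (ler_wpM2l _ (second_moment_le hS r a02 M0 (density_ge0 phiD) phiM)) _.
  by rewrite divr_ge0// divr_ge0// sqr_ge0.
rewrite le_eqVlt; apply/orP; left; apply/eqP.
have -> : r%:R `^ (2 - alpha) = r%:R ^+ 2 * r%:R `^ (- alpha) :> R.
  by rewrite powRDp// powR_mulrn// ltW.
by field; rewrite !gt_eqF//= subr_gt0.
Qed.

Lemma expR_le1B (x : R) : 0 <= x <= 2^-1 -> expR (- (2 * x)) <= 1 - x.
Proof.
move=> /andP[x0 x2]; apply: (@le_trans _ _ (1 + 2 * x)^-1).
  by rewrite expRN lef_pV2 ?posrE ?expR_gt0 ?expR_ge1Dx//; lra.
by rewrite -div1r ler_pdivrMr; nra.
Qed.

(** The test function at scale [r] keeps a proportion [1 - O(r ^ - alpha)] of its norm at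
each step, and spreading over its support costs at most [expR (V r)]. *)
Theorem return_lower (V : nat -> R) alpha M : test_family G V ->
  0 < alpha < 2 -> 0 <= M -> exists C : R, exists2 r0 : nat, 0 < C & (0 < r0)%N /\
   forall r phi n, (r0 <= r)%N -> sym_density phi -> tail_bound S phi alpha M ->
     (0 < n)%N ->
     expR (- (C * (n%:R * r%:R `^ (- alpha)) + V r)) <= conv_pow phi n.*2 1%g.
Proof.
move=> [f [U [fU fE]]] a02 M0; have /andP[a0 a2] := a02.
have ex s : exists C, 0 <= C /\ forall r, (0 < r)%N ->
    (energy (f r) s <= (C / r%:R ^+ 2)%:E * norm2 (f r))%E.
  by have [C C0 CE] := fE s; exists C.
have [Cs CsP] := choice ex.
pose c := \sum_(s <- S) Cs s.
have c0 : 0 <= c by apply: sumr_ge0 => s _; case: (CsP s).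
pose C := M + 4 * c * M / (2 - alpha).
have C0 : 0 <= C by rewrite addr_ge0// divr_ge0 ?mulr_ge0// subr_ge0 ltW.
pose r0 := (Num.truncn ((2 * C) `^ alpha^-1)).+1.
exists (8 * C + 1); exists r0; first by rewrite ltr_wpDl// mulr_ge0.
split => // r phi n r0r phiD phiM n0.
have rpos : (0 < r)%N by exact: leq_trans r0r.
have rR : 0 < r%:R :> R by rewrite ltr0n.
set x := C * r%:R `^ (- alpha).
have x0 : 0 <= x by rewrite mulr_ge0// powR_ge0.
have x2 : x <= 2^-1.
  rewrite /x powRN ler_pdivrMr ?powR_gt0// -ler_pdivrMl ?invr_gt0// invrK.
  have -> : 2 * C = ((2 * C) `^ alpha^-1) `^ alpha.
    by rewrite -powRrM mulVf ?gt_eqF// powRr1// mulr_ge0.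
  apply: ler_powR_base; rewrite ?powR_ge0 ?(ltW a0)//.
  by apply: le_trans (ltW (truncnS_gt _)) _; rewrite ler_nat.
have [f0 f1 fX UV] := fU r rpos.
set N2 := \sum_(y <- U r) f r y ^+ 2.
have U1 : 1%g \in U r by apply: contraTT f1 => /fX ->; rewrite ltxx.
have N20 : 0 < N2.
  rewrite /N2 (bigD1_seq 1%g) ?fset_uniq//= ltr_wpDr ?exprn_gt0//.
  by apply: sumr_ge0 => y _; exact: sqr_ge0.
have corrge : N2 * (1 - x) <= corr (f r) (U r) phi.
  apply: corr_density_ge => // s sS.
  have n2 : norm2 (f r) = N2%:E.
    apply: esum_fset_suppT => [y|y /fX ->]; first exact: sqr_ge0.
    by rewrite expr0n.
  apply: le_trans ((CsP s).2 r rpos) _; rewrite n2 -EFinM lee_fin.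
  rewrite ler_wpM2r ?(ltW N20)// ler_wpM2r ?invr_ge0 ?sqr_ge0//.
  rewrite /c (bigD1_seq s) ?fset_uniq//= lerDl.
  by apply: sumr_ge0 => t _; case: (CsP t).
(* the number of steps is rounded up to a power of 2 between [2 n] and [4 n] *)
pose t := trunc_log 2 n.*2.
have t1 : (2 ^ t <= n.*2)%N by rewrite trunc_logP// double_gt0.
have t2 : (n.*2 < 2 ^ t.+1)%N by rewrite trunc_log_ltn.
set m := (2 ^ t.+1)%N in t2.
have mE : m = (2 ^ t).*2 by rewrite /m expnS mul2n.
apply: (@le_trans _ _ (conv_pow phi m 1%g)); last first.
  by rewrite mE; apply: (conv_pow_double_homo phiD); rewrite -leq_double -mE ltnW.
have m0 : (0 < m)%N by rewrite expn_gt0.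
have corrle := corr_le_return phiD (U r) f0 (ltn0Sn t).
rewrite -/m -/N2 in corrle.
have Sf : (\sum_(y <- U r) f r y) ^+ 2 <= expR (V r) * N2.
  have := cauchy_schwarz_sum (U r) (fun=> 1) (f r).
  under eq_bigr do rewrite mul1r.
  move=> /le_trans; apply; rewrite ler_wpM2r ?(ltW N20)//.
  by under eq_bigr do rewrite expr1n; rewrite big_const_seq count_predT iter_addr_0.
have key : (1 - x) ^+ m <= conv_pow phi m 1%g * expR (V r).
  rewrite -(ler_pM2l (exprn_gt0 m N20)) -exprMn.
  apply: le_trans (_ : corr (f r) (U r) phi ^+ m <= _).
    rewrite lerXn2r// ?nnegrE; first by rewrite mulr_ge0 ?(ltW N20)//; lra.
    by apply: le_trans corrge; rewrite mulr_ge0 ?(ltW N20)//; lra.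
  apply: le_trans corrle _.
  have -> : N2 ^+ m = N2 * N2 ^+ m.-1 by rewrite -exprS prednK.
  rewrite [leRHS](_ : _ = conv_pow phi m 1%g * (expR (V r) * N2) * N2 ^+ m.-1); last by ring.
  rewrite ler_wpM2r ?exprn_ge0 ?(ltW N20)// ler_wpM2l ?conv_pow_ge0//.
rewrite opprD expRD expRN [expR (- V r)]expRN ler_pdivrMr ?expR_gt0//.
apply: le_trans key; apply: (@le_trans _ _ (expR (- (2 * x)) ^+ m)); last first.
  by rewrite lerXn2r ?nnegrE ?expR_ge0 ?expR_le1B ?x0//; lra.
rewrite -expRM_natr -expRN ler_expR mulNr lerN2.
have -> : (8 * C + 1) * (n%:R * r%:R `^ (- alpha)) = 2 * x * (4 * n%:R) + n%:R * r%:R `^ (- alpha).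
  by rewrite /x; ring.
apply: ler_wpDr; first by rewrite mulr_ge0// powR_ge0.
have le4 z : (z <= n.*2 -> z.*2 <= 4 * n)%N by clear; lia.
by rewrite ler_wpM2l ?mulr_ge0// -natrM ler_nat mE le4.
Qed.

End ReturnLower.

(** * Commuting copies of the lamp group *)

Section Copies.
Variable K : groupType.

Definition is_length (G : groupType) (l : G -> nat) : Prop :=
  [/\ l 1%g = 0%N, forall x y, (l (x * y)%g <= l x + l y)%N &
      forall x, l (x^-1)%g = l x].

(** This describes a direct sum of copies of [K] in [G] without its group structure: the
reading [rd i] sees the multiplications by the copy [e i], and no other. *)
Definition copies (G : groupType) (I : finType) (e : I -> K -> G)
    (rd : I -> G -> K) : Prop :=
  (forall i k k', e i (k * k')%g = (e i k * e i k')%g) /\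
  (forall i j k g, rd i (e j k * g)%g = if i == j then (k * rd i g)%g else rd i g).

(** The bound is asked of every length on [G], because a length restricts to the lamps and
to the base of a wreath product, whereas a generating set does not. *)
Definition has_copies (A : nat -> {fset K}) (N : nat -> nat) (G : groupType) : Prop :=
  forall l : G -> nat, is_length l -> exists C, forall r, (0 < r)%N ->
    exists (I : finType) (e : I -> K -> G) (rd : I -> G -> K),
      [/\ #|I| = N r, copies e rd &
        forall i k, k \in A r -> (l (e i k) <= C * r)%N].

Lemma trivial_copies (A : nat -> {fset K}) :
  (forall l : K -> nat, is_length l -> exists C, forall r k, (0 < r)%N ->
     k \in A r -> (l k <= C * r)%N) -> has_copies A (fun=> 1%N) K.
Proof.
move=> lA l /lA[C CA]; exists C => r r0.
exists unit, (fun=> id), (fun=> id); split=> [||i k kA]; first by rewrite card_unit.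
  by split=> // -[] [].
exact: CA.
Qed.

Lemma Zpow_length_le (d : nat) (l : Zpow d -> nat) : is_length l ->
  exists C, forall (r : nat) (t : {ffun 'I_d -> 'I_r}),
    (l (of_coord (fun i => (t i : nat)%:Z)) <= C * r)%N.
Proof.
move=> [l1 lM _]; pose u i : Zpow d := (delta_mx ord0 i : 'rV[int]_d).
exists (\sum_i l (u i))%N => r t.
have lX (v : 'rV[int]_d) n : (l (v *+ n : 'rV[int]_d) <= l v * n)%N.
  elim: n => [|n IH]; first by rewrite mulr0n (l1 : l (0 : 'rV[int]_d) = 0%N).
  by rewrite mulrS mulnS; apply: leq_trans (lM _ _) _; rewrite leq_add2l.
have -> : of_coord (fun i => (t i : nat)%:Z) =
    (\sum_i (delta_mx ord0 i *+ t i) : 'rV[int]_d).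
  apply/rowP => j; rewrite mxE summxE (bigD1 j)//= big1 ?addr0.
    rewrite mulmxnE mxE !eqxx/=. exact: esym (natz _).
  by move=> i ij; rewrite mulmxnE mxE eqxx/= eq_sym (negPf ij) mul0rn.
rewrite big_distrl/=.
elim/big_rec2: _ => [|i n v _ IH]; first by rewrite (l1 : l (0 : 'rV[int]_d) = 0%N).
apply: leq_trans (lM _ _) _; rewrite leq_add//; apply: leq_trans (lX _ _) _.
by rewrite leq_mul2l orbC ltnW// ltn_ord.
Qed.

(** A copy in [L] can be carried by the lamp at any of the [r ^ d] points of a box. *)
Lemma wreath_has_copies (A : nat -> {fset K}) (N : nat -> nat) (L : groupType) (d : nat) :
  has_copies A N L -> has_copies A (fun r => N r * r ^ d)%N (wreath L (Zpow d)).
Proof.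
move=> LN l [l1 lM lV].
have lL : is_length (fun x => l (at_lamp (1%g : Zpow d) x)).
  split=> [|x y|x]; first by rewrite at_lamp1.
    by rewrite at_lampM.
  have -> : at_lamp (1%g : Zpow d) (x^-1)%g = ((at_lamp (1%g : Zpow d) x)^-1)%g.
    by apply/eqP; rewrite -mulg_eq1 -at_lampM mulVg at_lamp1.
  exact: lV.
have lB : is_length (fun x => l (at_base L x : wreath L (Zpow d))).
  split=> [|x y|x]; [by []|by rewrite at_baseM|].
  have -> : at_base L (x^-1)%g = ((at_base L x)^-1)%g.
    by apply/eqP; rewrite -mulg_eq1 -at_baseM mulVg.
  exact: lV.
have [C CP] := LN _ lL; have [C' C'P] := Zpow_length_le lB.
exists (C' + C + C')%N => r r0; have [I [e [rd [IN [eM rdE] lC]]]] := CP r r0.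
pose z (t : {ffun 'I_d -> 'I_r}) : Zpow d := of_coord (fun i => (t i : nat)%:Z).
have z_inj : injective z.
  move=> t t' E; apply/ffunP => i; apply/val_inj.
  by have := congr1 (fun x => coord x i) E; rewrite !coordE => -[].
exists (I * {ffun 'I_d -> 'I_r})%type.
exists (fun p k => at_lamp (z p.2) (e p.1 k)).
exists (fun p (a : wreath L (Zpow d)) => rd p.1 (a.1 (z p.2))); split.
- by rewrite card_prod card_ffun !card_ord IN.
- split=> [[i t] k k'|[i t] [j t'] k a] /=; first by rewrite eM at_lampM.
  rewrite restr_prodM lampE wr_shiftE invg1 mul1g (inj_eq z_inj) xpair_eqE.
  by case: (t =P t') => [->|_]; rewrite ?andbT ?andbF ?mul1g// rdE.
- move=> [i t] k kA /=; rewrite at_baseJ; apply: leq_trans (lM _ _) _.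
  rewrite mulnDl leq_add//; last first.
    by have [_ _ ->] := lB; exact: C'P.
  apply: leq_trans (lM _ _) _; rewrite mulnDl leq_add//; first exact: C'P.
  exact: lC.
Qed.

Lemma iter_wreath_has_copies (A : nat -> {fset K}) (N : nat -> nat) (L : groupType)
    (ds : seq nat) : has_copies A N L ->
  has_copies A (fun r => N r * r ^ (\sum_(i <- ds) i))%N (iter_wreath L ds).
Proof.
elim: ds L N => [|d ds IH] L N LN.
  move=> l /LN[C CP]; exists C => r r0; have [I [e [rd [IN H1 H2]]]] := CP r r0.
  by exists I, e, rd; split => //; rewrite big_nil muln1.
move=> l /(IH _ _ (wreath_has_copies (d := d) LN))[C CP]; exists C => r r0.
have [I [e [rd [IN H1 H2]]]] := CP r r0.
by exists I, e, rd; split => //; rewrite IN big_cons expnD mulnA.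
Qed.

End Copies.

(** * Random walks refreshing the copies *)

Lemma bernoulli_pow (R : realType) (x y : R) n : 0 <= y <= x ->
  x ^+ n - n%:R * x ^+ n.-1 * y <= (x - y) ^+ n.
Proof.
move=> /andP[y0 yx]; have x0 : 0 <= x by exact: le_trans yx.
elim: n => [|n IH]; first by rewrite !expr0 !mul0r subr0.
have xy : 0 <= x - y by rewrite subr_ge0.
rewrite [leRHS]exprS; apply: le_trans (ler_wpM2l xy IH).
case: n {IH} => [|n]; first by rewrite le_eqVlt; apply/orP; left; apply/eqP => /=; ring.
rewrite -subr_ge0 /= (_ : _ - _ = n.+1%:R * x ^+ n * y ^+ 2).
  by rewrite mulr_ge0 ?sqr_ge0// mulr_ge0// exprn_ge0.
by rewrite -[n.+2%:R]natr1 !exprS; ring.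
Qed.

Section Refresh.
Variables (R : realType) (K G : groupType) (I : finType).
Variables (e : I -> K -> G) (rd : I -> G -> K).
Hypothesis eK : copies e rd.
Variable A : {fset K}.
Hypothesis A1 : 1%g \in A.
Hypothesis AV : fsymmetric A.
Variable i0 : I.

Local Notation N := (#|I|%:R : R).
Local Notation q := (#|` A|%:R^-1 : R).

Let N0 : 0 < N. Proof. by rewrite ltr0n; apply/card_gt0P; exists i0. Qed.
Let A0 : 0 < #|` A|%:R :> R.
Proof. by rewrite ltr0n cardfs_gt0; apply/fset0Pn; exists 1%g. Qed.

(** The law of a step that puts a uniform element of [A] in a uniform copy. *)
Definition refresh (x : G) : R :=
  q / N * \sum_i \sum_(a <- A) (x == e i a)%:R.

Definition refresh_supp : {fset G} := [fset e i a | i in I, a in A]%fset.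

Lemma copies1 i : e i 1%g = 1%g.
Proof. by apply: (mulgI (e i 1%g)); rewrite -eK.1 !mulg1. Qed.

Lemma copiesV i k : e i (k^-1)%g = ((e i k)^-1)%g.
Proof. by apply/eqP; rewrite -mulg_eq1 -eK.1 mulVg copies1. Qed.

Lemma mem_refresh_supp i a : a \in A -> e i a \in refresh_supp.
Proof. by move=> aA; apply/imfset2P; exists i => //; exists a. Qed.

Lemma refresh_ge0 x : 0 <= refresh x.
Proof.
rewrite mulr_ge0 ?divr_ge0 ?invr_ge0//.
by apply: sumr_ge0 => i _; exact: sumr_ge0.
Qed.

Lemma refresh_eq0 x : x \notin refresh_supp -> refresh x = 0.
Proof.
move=> xX; rewrite /refresh big1 ?mulr0// => i _; rewrite big_seq big1// => a aA.
by case: eqP => // xe; move: xX; rewrite xe mem_refresh_supp.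
Qed.

Lemma sum_refresh (f : G -> R) :
  \sum_(x <- refresh_supp) refresh x * f x =
    q / N * \sum_i \sum_(a <- A) f (e i a).
Proof.
under eq_bigr => x _ do rewrite /refresh -mulrA mulr_suml.
rewrite -mulr_sumr exchange_big/=; congr (_ * _); apply: eq_bigr => i _.
under eq_bigr => x _ do rewrite mulr_suml.
rewrite exchange_big/= big_seq [RHS]big_seq; apply: eq_bigr => a aA.
rewrite (bigD1_seq (e i a)) ?fset_uniq ?mem_refresh_supp//= eqxx mul1r.
by rewrite big1 ?addr0// => x /negPf ->; rewrite mul0r.
Qed.

Lemma refresh_density : sym_density refresh.
Proof.
split=> [x|x|]; first exact: refresh_ge0.
  rewrite /refresh; congr (_ * _); apply: eq_bigr => i _.
  have -> : \sum_(a <- A) (x == e i a)%:R =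
      \sum_(a <- [fset a^-1%g | a in A]%fset) (x == e i a)%:R :> R.
    apply: eq_fbigl => a; apply/idP/imfsetP => /= [aA|[b bA ->]]; last exact: AV.
    by exists (a^-1)%g; rewrite ?invgK//; exact: AV.
  rewrite big_imfset/=; last by move=> ? ? _ _; exact: invg_inj.
  by apply: eq_bigr => a _; rewrite copiesV (can2_eq (@invgK G) (@invgK G)).
rewrite (esum_fset_suppT refresh_ge0 refresh_eq0); congr _%:E.
under eq_bigr do rewrite -[refresh _]mulr1.
rewrite (sum_refresh (fun=> 1)).
under eq_bigr do rewrite big_const_seq count_predT iter_addr_0.
by rewrite sumr_const -mulr_natr; field; rewrite !gt_eqF.
Qed.

(** The expectation of [f] at the position of the walk after [m] steps, with the first step
split off: steps multiply on the left, where the readings can see them. *)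
Fixpoint refresh_mean m (f : G -> R) : R :=
  if m is m'.+1 then
    q / N * \sum_i \sum_(a <- A) refresh_mean m' (fun g => f (e i a * g)%g)
  else f 1%g.

Lemma refresh_mean_le m f f' : (forall g, f g <= f' g) ->
  refresh_mean m f <= refresh_mean m f'.
Proof.
elim: m f f' => [|m IH] f f' ff' //=.
rewrite ler_wpM2l ?divr_ge0 ?invr_ge0//.
by apply: ler_sum => i _; apply: ler_sum => a _; exact: IH.
Qed.

Lemma refresh_mean_sum m (T : Type) (r : seq T) (f : T -> G -> R) :
  refresh_mean m (fun g => \sum_(t <- r) f t g) =
    \sum_(t <- r) refresh_mean m (f t).
Proof.
elim: m f => [|m IH] f //=; rewrite -mulr_sumr; congr (_ * _).
rewrite [RHS]exchange_big/=; apply: eq_bigr => i _.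
by rewrite [RHS]exchange_big/=; apply: eq_bigr => a _; rewrite IH.
Qed.

Lemma refresh_meanE m x : conv_pow refresh m x = refresh_mean m (fun g => (g == x)%:R).
Proof.
have ext n f f' : f =1 f' -> refresh_mean n f = refresh_mean n f'.
  by move=> ff'; congr refresh_mean; apply/funext.
elim: m x => [|m IH] x; first by rewrite conv_pow0 eq_sym.
apply/EFin_inj; rewrite (conv_powSE refresh_density).
rewrite (@esum_fset_suppT _ _ refresh_supp); last 2 first.
- by move=> y; rewrite mulr_ge0 ?refresh_ge0// (conv_pow_ge0 refresh_density).
- by move=> y /refresh_eq0 ->; rewrite mul0r.
rewrite (sum_refresh (fun y => conv_pow refresh m (y^-1 * x)%g)) /=.
congr (_ * _)%:E; apply: eq_bigr => i _; apply: eq_bigr => a _.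
rewrite IH; apply: ext => g; congr (nat_of_bool _)%:R.
by rewrite (can2_eq (mulKg _) (mulVKg _)).
Qed.

Let level (J : {set I}) (w : I -> K) (g : G) : R := \prod_(i in J) (rd i g == w i)%:R.

(** This bounds the probability that the readings in [J] have prescribed values. A step in
a copy outside [J] does not change the event. For a step in a copy [i] of [J], the events
obtained for the various elements of [A] are disjoint and force the readings of the
other elements of [J], whence a factor [q]. Bernoulli's inequality shows that powers of
[q + (1 - 1 / N) ^ m] solve the resulting recursion. *)
Lemma refresh_mean_level m (J : {set I}) w :
  refresh_mean m (level J w) <= (q + (1 - N^-1) ^+ m) ^+ #|J|.
Proof.
have N1 : 1 <= N by rewrite ler1n -(ltr0n R).
have NV : 0 <= 1 - N^-1 <= 1.
  by rewrite subr_ge0 gerBl invr_ge0 (ltW N0) andbT invf_le1.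
have q0 : 0 < q by rewrite invr_gt0.
elim: m J w => [|m IH] J w /=.
  rewrite expr0; apply: (@le_trans _ _ 1).
    by apply: prodr_ile1 => i _; rewrite ler0n lern1; case: (_ == _).
  by rewrite exprn_ege1// lerDr ltW.
set x := q + (1 - N^-1) ^+ m in IH.
have xq : q <= x by rewrite lerDl exprn_ge0//; case/andP: NV.
have x0 : 0 < x by exact: lt_le_trans xq.
have out i : i \notin J ->
    \sum_(a <- A) refresh_mean m (fun g => level J w (e i a * g)%g) <= #|` A|%:R * x ^+ #|J|.
  move=> iJ; rewrite mulr_natl -iter_addr_0 -[X in iter X](count_predT A) -big_const_seq.
  apply: ler_sum => a _; apply: le_trans (IH J w); apply: refresh_mean_le => g.
  apply: ler_prod => j jJ; rewrite ler0n/= eK.2.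
  by have [ji|//] := eqVneq j i; rewrite -ji jJ in iJ.
have inn i : i \in J ->
    \sum_(a <- A) refresh_mean m (fun g => level J w (e i a * g)%g) <= x ^+ #|J|.-1.
  move=> iJ; rewrite -refresh_mean_sum.
  have -> : #|J|.-1 = #|J :\ i| by rewrite (cardsD1 i J) iJ.
  apply: le_trans (IH (J :\ i)%SET w); apply: refresh_mean_le => g.
  have E a : level J w (e i a * g)%g =
      (a == w i * (rd i g)^-1)%g%:R * level (J :\ i)%SET w g.
    rewrite /level (big_setD1 i)//= eK.2 eqxx; congr (_ * _).
      by rewrite (can2_eq (mulgK _) (mulgVK _)).
    apply: eq_bigr => j; rewrite !inE => /andP[ji _].
    by rewrite eK.2 (negPf ji).
  under eq_bigr do rewrite E.
  rewrite -mulr_suml -[leRHS]mul1r ler_wpM2r ?prodr_ge0//.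
  have [wA|wA] := boolP ((w i * (rd i g)^-1)%g \in A).
    rewrite (bigD1_seq _ wA) ?fset_uniq//= eqxx big1 ?addr0// => a /negPf ->.
    by [].
  by rewrite big_seq big1// => a aA; case: eqP => // aw; rewrite -aw aA in wA.
rewrite (bigID (mem J))/=.
apply: (@le_trans _ _ (q / N * (#|J|%:R * x ^+ #|J|.-1 + (N - #|J|%:R) * (#|` A|%:R * x ^+ #|J|)))).
  rewrite ler_wpM2l ?divr_ge0 ?invr_ge0//.
  apply: lerD.
    by rewrite [leRHS]mulr_natl -sumr_const; apply: ler_sum => i iJ; exact: inn.
  have -> : N - #|J|%:R = #|~: J|%:R.
    by rewrite -(cardsC J) natrD addrAC subrr add0r.
  rewrite [leRHS]mulr_natl -sumr_const.
  under [leRHS]eq_bigl => i do rewrite finset.in_setC.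
  by apply: ler_sum => i iJ; exact: out.
have -> : q + (1 - N^-1) ^+ m.+1 = x - (x - q) / N.
  by rewrite /x exprS; field; rewrite !gt_eqF.
apply: le_trans (bernoulli_pow _ _); last first.
  rewrite divr_ge0 ?subr_ge0 ?(ltW N0)//= ler_pdivrMr//.
  by apply: (@le_trans _ _ x); rewrite ?gerBl ?(ltW q0)// ler_peMr// ltW.
case: (posnP #|J|) => [->|J0].
  rewrite !expr0 !mul0r !mulr1 add0r subr0 subr0.
  by rewrite le_eqVlt; apply/orP; left; apply/eqP; field; rewrite !gt_eqF.
rewrite -[in X in _ <= X - _](prednK J0) -[in X in _ * (_ * X)](prednK J0) exprS.
by rewrite le_eqVlt; apply/orP; left; apply/eqP; field; rewrite !gt_eqF.
Qed.

(** Sites are refreshed independently, so the return probability is at most that of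
a product of [#|I|] independent walks; each of them is back at 1 with probability
about [1 / #|A|] once it has been refreshed. *)
Theorem refresh_return m : conv_pow refresh m 1%g <= (q + (1 - N^-1) ^+ m) ^+ #|I|.
Proof.
rewrite refresh_meanE -[X in _ ^+ X]cardsT; apply: le_trans (refresh_mean_level m _ (fun i => rd i 1%g)).
apply: refresh_mean_le => g; case: eqP => [->|_].
  by rewrite /level big1// => i _; rewrite eqxx.
by rewrite prodr_ge0.
Qed.

End Refresh.

(** * Upper bounds on return probabilities *)

Section Decay.
Variables (R : realType) (G : groupType) (phi psi : G -> R) (X Z : {fset G}).
Hypothesis phiD : sym_density phi.
Hypothesis phiX : forall x, x \notin X -> phi x = 0.
Hypothesis psiD : sym_density psi.
Hypothesis psiZ : forall x, x \notin Z -> psi x = 0.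
Variables (delta eps : R).
Hypothesis delta0 : 0 <= delta.
Hypothesis eps0 : 0 <= eps.
Hypothesis phi1 : delta <= phi 1%g.
Hypothesis psi_phi : forall z, z != 1%g -> eps * psi z <= phi z.

Local Notation S n := (conv_pow phi n).

Let S0 n x : 0 <= S n x. Proof. exact: conv_pow_ge0. Qed.
Let psi0 x : 0 <= psi x. Proof. exact: density_ge0. Qed.

Lemma conv_pow_double_autocorr n z :
  S n.*2 z = \sum_(x <- fset_exp X n) S n x * S n (x * z)%g.
Proof.
apply/EFin_inj; rewrite -addnn (conv_powD phiD) -esum_invg.
under eq_esum => y _ do rewrite (conv_pow_sym phiD) invgK.
rewrite (@esum_fset_suppT _ _ (fset_exp X n))//; first by move=> y; rewrite mulr_ge0.
by move=> y /(conv_pow_supp phiD phiX) ->; rewrite mul0r.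
Qed.

Let form n := \sum_(z <- Z) psi z * S n.*2 z.

Let psi_mass : \sum_(z <- Z) psi z = 1.
Proof.
by apply/EFin_inj; rewrite -(density_mass psiD) (esum_fset_suppT psi0 psiZ).
Qed.

(** [form n] is the quadratic form of [psi] at [S n]. *)
Lemma form_le n k : (0 < k)%N ->
  form n ^+ (2 ^ k) <= conv_pow psi (2 ^ k) 1%g * S n.*2 1%g ^+ (2 ^ k).-1.
Proof.
move=> k0; pose Y := fset_exp X n.
have SY x : x \notin Y -> S n x = 0 by exact: conv_pow_supp.
have le1 : form n <= corr (S n) Y psi.
  apply: le_trans (corr_ge (S0 n) Z psi0 SY).
  by apply: ler_sum => z _; rewrite conv_pow_double_autocorr.
have form0 : 0 <= form n by apply: sumr_ge0 => z _; rewrite mulr_ge0.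
apply: (@le_trans _ _ (corr (S n) Y psi ^+ (2 ^ k))).
  by rewrite lerXn2r// nnegrE (le_trans form0).
apply: le_trans (corr_le_return psiD Y (S0 n) k0) _.
have -> : \sum_(x <- Y) S n x ^+ 2 = S n.*2 1%g.
  by rewrite conv_pow_double_autocorr; apply: eq_bigr => x _; rewrite mulg1 expr2.
rewrite ler_wpM2r ?exprn_ge0// -[leRHS]mulr1 ler_wpM2l ?conv_pow_ge0//.
rewrite expr_le1//; last exact: sumr_ge0.
by rewrite -lee_fin -(conv_pow_mass phiD n) -(esum_fset_suppT (S0 n) SY).
Qed.

(** Two steps of [phi] include a step of [psi] with probability at least
[2 * delta * eps], the other step being trivial; a trivial step excludes the parity
phenomena that would hide the decay. *)
Lemma conv_pow_double_drop n :
  S n.+1.*2 1%g <= S n.*2 1%g - 2 * delta * eps * (S n.*2 1%g - form n).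
Proof.
have max z : 0 <= S n.*2 1%g - S n.*2 z by rewrite subr_ge0 conv_pow_double_max.
rewrite lerBrDr -lee_fin EFinD doubleS -[_.+2]add2n (conv_powD phiD).
have -> : S n.*2 1%g - form n = \sum_(z <- Z) psi z * (S n.*2 1%g - S n.*2 z).
  rewrite /form; under [RHS]eq_bigr do rewrite mulrBr.
  by rewrite sumrB -mulr_suml psi_mass mul1r.
apply: (@le_trans _ _ (\esum_(y in [set: G]) (S 2 y * S n.*2 y)%:E +
    \esum_(y in [set: G]) (S 2 y * (S n.*2 1%g - S n.*2 y))%:E)%E).
  apply: leeD; first by apply: le_esum_fin => y _; rewrite mulg1 conv_pow_sym.
  rewrite mulr_sumr; apply: le_trans (_ : ((\sum_(z <- Z) S 2 z * (S n.*2 1%g - S n.*2 z))%:E <= _)%E).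
    rewrite lee_fin; apply: ler_sum => z _.
    have [->|z1] := eqVneq z 1%g; first by rewrite subrr !mulr0.
    rewrite mulrA ler_wpM2r//; apply: le_trans (conv_pow2_lazy phiD z1).
    rewrite -mulrA ler_pM ?mulr_ge0//; last exact: psi_phi.
    by rewrite ler_wpM2l.
  by apply: esum_le_fset => // y; rewrite mulr_ge0.
rewrite -esumD; try by move=> y _; rewrite lee_fin mulr_ge0.
apply: (@le_trans _ _ (\esum_(y in [set: G]) (S n.*2 1%g * S 2 y)%:E)%E).
  by apply: le_esum_fin => y _; lra.
by rewrite esumZl// (conv_pow_mass phiD) mule1.
Qed.

(** As long as [S n.*2 1%g] exceeds [v], the walk is too concentrated to be preserved by
the steps of [psi], and each step of [phi] costs a fixed proportion of this norm. *)
Theorem return_decay (theta v : R) k n : (0 < k)%N -> 0 <= theta <= 1 -> 0 < v ->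
  conv_pow psi (2 ^ k) 1%g <= theta ^+ (2 ^ k) * v ->
  S n.*2 1%g <= v \/ S n.*2 1%g <= expR (- (2 * delta * eps * (1 - theta) * n%:R)).
Proof.
move=> k0 /andP[t0 t1] v0 psiv; elim: n => [|n IH].
  right; rewrite mulr0 oppr0 expR0.
  by case/andP: (conv_pow_01 phiD 0.*2 1%g).
have [av|va] := leP (S n.*2 1%g) v.
  by left; apply: le_trans av; exact: conv_pow_double_decr.
right; case: IH => [|an]; first by rewrite leNgt va.
set a := S n.*2 1%g in va an *.
have a0 : 0 < a by exact: lt_trans va.
have fa : form n <= theta * a.
  rewrite -(@ler_pXn2r _ (2 ^ k)) ?expn_gt0 ?nnegrE ?mulr_ge0 ?(ltW a0)//; last first.
    by apply: sumr_ge0 => z _; rewrite mulr_ge0.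
  apply: le_trans (form_le n k0) _.
  apply: le_trans (ler_wpM2r (exprn_ge0 _ (ltW a0)) psiv) _.
  rewrite exprMn -mulrA ler_wpM2l ?exprn_ge0//.
  rewrite -[in leRHS](prednK (_ : 0 < 2 ^ k)%N) ?expn_gt0// exprS.
  by rewrite ler_wpM2r ?exprn_ge0 ?(ltW a0)// ltW.
apply: le_trans (conv_pow_double_drop n) _; rewrite -/a.
set y := 2 * delta * eps * (1 - theta).
have y0 : 0 <= 2 * delta * eps by rewrite !mulr_ge0.
apply: (@le_trans _ _ (a * (1 - y))).
  rewrite (_ : a * (1 - y) = a - 2 * delta * eps * (a - theta * a)); last by rewrite /y; ring.
  by rewrite lerB// ler_wpM2l// lerB.
have -> : - (y * n.+1%:R) = - (y * n%:R) - y by rewrite -natr1; ring.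
rewrite expRD.
apply: (@le_trans _ _ (a * expR (- y))).
  by rewrite ler_wpM2l ?(ltW a0)// expR_ge1Dx.
by rewrite ler_wpM2r ?expR_ge0.
Qed.

End Decay.

Lemma exists_pow2 (R : realType) (x : R) : 1 <= x ->
  exists2 k, (0 < k)%N & x <= (2 ^ k)%N%:R <= 2 * x.
Proof.
move=> x1; have x0 : 0 <= x by exact: le_trans x1.
have n0 : (0 < Num.truncn x)%N by rewrite truncn_gt0.
exists (trunc_log 2 (Num.truncn x)).+1 => //; apply/andP; split.
  apply: le_trans (ltW (truncnS_gt x)) _.
  by rewrite ler_nat trunc_log_ltn.
rewrite expnS natrM ler_wpM2l//; apply: le_trans (_ : (Num.truncn x)%:R <= _).
  by rewrite ler_nat trunc_logP.
by rewrite truncn_le.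
Qed.

Section RefreshDecay.
Variables (R : realType) (K G : groupType) (I : finType).
Variables (e : I -> K -> G) (rd : I -> G -> K) (A : {fset K}) (i0 : I).
Hypothesis eK : copies e rd.
Hypothesis A1 : 1%g \in A.
Hypothesis AV : fsymmetric A.
Hypothesis A2 : (1 < #|` A|)%N.

(** After a number of steps of order [#|I| * ln #|` A|], all the copies have been
refreshed but a small fraction. *)
Lemma refresh_small_return :
  let W : R := #|I|%:R * ln #|` A|%:R in
  exists2 k, (0 < k)%N & conv_pow (refresh R e A) (2 ^ k) 1%g <=
    expR (- 32^-1) ^+ (2 ^ k) * expR (- (W / 8)).
Proof.
move=> W; set N : R := #|I|%:R; set l : R := ln #|` A|%:R.
have N1 : 1 <= N by rewrite ler1n; apply/card_gt0P; exists i0.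
have A0 : 2 <= #|` A|%:R :> R by rewrite ler_nat.
have lE : expR l = #|` A|%:R by rewrite lnK// posrE; lra.
have l2 : 2^-1 <= l.
  rewrite -ler_expR lE; apply: le_trans A0.
  rewrite -[2^-1]opprK expRN -[leRHS]invrK lef_pV2 ?posrE ?expR_gt0//.
  by apply: le_trans (expR_ge1Dx _); lra.
have WN : N * 2^-1 <= W by rewrite /W ler_wpM2l//; lra.
have W2 : 1 <= 2 * W by lra.
(* With [2 W <= m <= 4 W], the return probability is at most [expR (- W / 4)]. Half of
   this exponent is spent on [expR (- 32^-1) ^+ m], which is at least [expR (- W / 8)]. *)
have [k k0 /andP[mk km]] := exists_pow2 W2.
exists k => //; set m := (2 ^ k)%N in mk km *.
apply: le_trans (refresh_return R eK A1 AV i0 m) _.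
set q : R := #|` A|%:R^-1; have qE : q = expR (- l) by rewrite expRN lE.
have q0 : 0 < q by rewrite qE expR_gt0.
have q2 : q <= 2^-1 by rewrite lef_pV2 ?posrE//; lra.
have NV : 0 <= 1 - N^-1 by rewrite subr_ge0 invf_le1//; lra.
have le1 : (1 - N^-1) ^+ m <= q ^+ 2.
  apply: (@le_trans _ _ (expR (- N^-1) ^+ m)).
    by rewrite lerXn2r ?nnegrE ?expR_ge0// expR_ge1Dx.
  rewrite qE -!expRM_natr ler_expR !mulNr lerN2.
  rewrite [leRHS]mulrC ler_pdivlMr; last by lra.
  by apply: le_trans mk; rewrite /W -/N -/l; lra.
have le2 : q + (1 - N^-1) ^+ m <= expR (- (l / 4)).
  apply: (@le_trans _ _ (3 / 2 * q)); first by nra.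
  rewrite -(@ler_pXn2r _ 4)// ?nnegrE ?expR_ge0//; last by lra.
  rewrite -expRM_natr (_ : - (l / 4) * 4%:R = - l); last by field.
  have q3 : q ^+ 3 <= 2^-1 ^+ 3 by rewrite lerXn2r// nnegrE; lra.
  rewrite -qE (_ : (3 / 2 * q) ^+ 4 = q * ((3 / 2) ^+ 4 * q ^+ 3)); last by ring.
  by rewrite -[leRHS]mulr1 ler_wpM2l ?(ltW q0)//; lra.
apply: (@le_trans _ _ (expR (- (l / 4)) ^+ #|I|)).
  by rewrite lerXn2r// nnegrE ?expR_ge0// addr_ge0 ?exprn_ge0// ltW.
rewrite -!expRM_natr -expRD ler_expR.
have -> : - (l / 4) * #|I|%:R = - (W / 4) by rewrite /W -/N -/l; field.
lra.
Qed.

End RefreshDecay.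

(** * Perturbing a spread density *)

Section Spread.
Variables (R : realType) (G : groupType) (S : {fset G}) (alpha kappa M : R).
Hypothesis hS : sym_generating S.
Hypothesis alpha0 : 0 < alpha.
Implicit Types (phi psi : G -> R).

Local Notation wl := (word_length S).
Local Notation rho := (rho_pow S alpha).
Local Notation above s := [set x : G | (s < rho x)%R].

Definition admissible phi : Prop :=
  [/\ sym_density phi, forall x, phi x <= kappa &
    forall s : R, 0 < s ->
      (s%:E * (\esum_(x in above s) (phi x)%:E) <= M%:E)%E].

Definition dirac_pair (y x : G) : R := 2^-1 * (x == y)%:R + 2^-1 * (x == y^-1%g)%:R.

Lemma rho_ge1 x : 1 <= rho x.
Proof.
have : 1 `^ alpha <= rho x by rewrite ler_powR_base ?(ltW alpha0)// lerDl.
by rewrite powR1.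
Qed.

Lemma rho_le x y : (rho x <= rho y) = (wl x <= wl y)%N.
Proof.
apply/idP/idP => [h|h]; last by rewrite ler_powR_base ?(ltW alpha0) ?addr_ge0// lerD2l ler_nat.
rewrite leqNgt; apply/negP => yx; move: h; rewrite leNgt => /negP; apply.
by rewrite gt0_ltr_powR// ?nnegrE ?addr_ge0// ltrD2l ltr_nat.
Qed.

Lemma rho_lt x y : (rho x < rho y) = (wl x < wl y)%N.
Proof. by rewrite ltNge rho_le -ltnNge. Qed.

Lemma dirac_pair_ge0 y x : 0 <= dirac_pair y x.
Proof. by rewrite addr_ge0// mulr_ge0. Qed.

Lemma dirac_pair_le1 y x : dirac_pair y x <= 1.
Proof. by rewrite /dirac_pair; case: (_ == _); case: (_ == _) => /=; lra. Qed.

Lemma dirac_pair_sym y x : dirac_pair y x^-1%g = dirac_pair y x.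
Proof.
by rewrite /dirac_pair addrC (inj_eq invg_inj) (can2_eq (@invgK G) (@invgK G)).
Qed.

Lemma dirac_pair_eq0 y x : wl x != wl y -> dirac_pair y x = 0.
Proof.
move=> xy; rewrite /dirac_pair.
have [xE|_] := eqVneq x y; first by rewrite xE eqxx in xy.
have [xE|_] := eqVneq x (y^-1)%g; first by rewrite xE word_lengthV// eqxx in xy.
by rewrite !mulr0 addr0.
Qed.

Lemma esum_dirac (B : set G) (y : G) :
  \esum_(x in B) ((x == y)%:R : R)%:E = ((y \in B)%:R)%:E.
Proof.
rewrite (@esum_fset_supp _ _ [fset y]%fset)//; last by move=> x; rewrite inE => /negPf ->.
by rewrite big_mkcond/= big_seq_fset1 eqxx; case: ifP.
Qed.

Lemma esum_dirac_pair (B : set G) (y : G) : (y^-1%g \in B) = (y \in B) ->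
  \esum_(x in B) (dirac_pair y x)%:E = ((y \in B)%:R)%:E.
Proof.
move=> yB; under eq_esum => x _ do rewrite /dirac_pair EFinD.
rewrite esumD; try by move=> x _; rewrite lee_fin mulr_ge0.
rewrite !esumZl// ?invr_ge0// !esum_dirac yB -EFinM -EFinD; congr _%:E.
by case: (_ \in _) => /=; lra.
Qed.

Lemma mem_rho_ball s y : (y^-1%g \in above s) = (y \in above s).
Proof.
by apply/idP/idP => /set_mem h; apply: mem_set; move: h;
  rewrite /= /rho_pow word_lengthV.
Qed.

Lemma esum_fin phi (B : set G) : sym_density phi ->
  exists2 m : R, 0 <= m <= 1 & \esum_(x in B) (phi x)%:E = m%:E.
Proof.
move=> phiD; have [p0 _ p1] := phiD.
have e0 : (0 <= \esum_(x in B) (phi x)%:E)%E by apply: esum_ge0 => x _; rewrite lee_fin.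
have e1 : (\esum_(x in B) (phi x)%:E <= 1)%E.
  rewrite -p1 [leLHS]esum_mkcond; apply: le_esum => x _.
  by case: ifP => _; rewrite lee_fin.
have ef : \esum_(x in B) (phi x)%:E \is a fin_num.
  by rewrite ge0_fin_numE// (le_lt_trans e1)// ltry.
exists (fine (\esum_(x in B) (phi x)%:E)); last by rewrite fineK.
by rewrite -!lee_fin fineK// e0 e1.
Qed.

Lemma admissible_M_ge1 phi : admissible phi -> 1 <= M.
Proof.
move=> [[_ _ p1] _ pM]; rewrite leNgt; apply/negP => M1.
pose s := Num.max (2^-1) ((1 + M) / 2).
have s0 : 0 < s by rewrite lt_max invr_gt0 ltr0n.
have s1 : s < 1 by rewrite gt_max; apply/andP; split; lra.
have Ms : M < s by rewrite lt_max; apply/orP; right; lra.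
have := pM s s0; rewrite (_ : above s = setT) ?p1 ?mule1 ?lee_fin.
  by rewrite leNgt Ms.
by apply/seteqP; split => // x _ /=; apply: lt_le_trans (rho_ge1 x).
Qed.

Lemma admissible_kappa_gt0 phi : admissible phi -> 0 < kappa.
Proof.
move=> [[p0 _ p1] pk _]; rewrite ltNge; apply/negP => k0.
have : (\esum_(x in [set: G]) (phi x)%:E = 0)%E.
  apply: esum1 => x _; congr _%:E; apply/eqP; rewrite eq_le p0 andbT.
  exact: le_trans (pk x) k0.
by rewrite p1 => /eqP; rewrite onee_eq0.
Qed.

Lemma admissible_tail phi : admissible phi -> tail_bound S phi alpha M.
Proof.
move=> [_ _ pM]; apply: weak_moment_tail => //.
by apply: ge_ereal_sup => _ [s s0 <-]; exact: pM.
Qed.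

(** Moving the mass inwards preserves the moment condition: the mass far away, which
is at most [kappa], is gathered at an element of least length among its support. *)
Lemma admissible_truncate phi : admissible phi -> exists phi1 (X : {fset G}),
  admissible phi1 /\ forall x, x \notin X -> phi1 x = 0.
Proof.
move=> phiA; have [phiD pk pM] := phiA; have [p0 psym p1] := phiD.
have k0 := admissible_kappa_gt0 phiA; have M1 := admissible_M_ge1 phiA.
pose N := (Num.truncn ((M / kappa) `^ alpha^-1)).+1.
have MN : M * N%:R `^ (- alpha) <= kappa.
  rewrite powRN ler_pdivrMr ?powR_gt0 ?ltr0n// mulrC -ler_pdivrMr//.
  have Mk0 : 0 <= M / kappa by rewrite divr_ge0 ?(ltW k0)//; lra.
  have -> : M / kappa = ((M / kappa) `^ alpha^-1) `^ alpha.
    by rewrite -powRrM mulVf ?gt_eqF// powRr1.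
  apply: ler_powR_base; rewrite ?powR_ge0 ?(ltW alpha0)//.
  exact: ltW (truncnS_gt _).
have [[y0 [y0N y0p]]|nex] := pselect (exists y, (N <= wl y)%N /\ phi y != 0); last first.
  exists phi, (word_ball S N); split => // x; rewrite word_ballP// -ltnNge => xN.
  apply/eqP; apply: contra_notT nex => px; exists x; split => //; exact: ltnW.
have [y [yN yp ymin]] : exists y, [/\ (N <= wl y)%N, phi y != 0 &
    forall x, (N <= wl x)%N -> phi x != 0 -> (wl y <= wl x)%N].
  pose P n := `[< exists y, [/\ (N <= wl y)%N, phi y != 0 & wl y = n] >].
  have exP : exists n, P n by exists (wl y0); apply/asboolP; exists y0.
  case: (ex_minnP exP) => n /asboolP[y [yN yp yn]] nmin; exists y; split => // x xN xp.
  by rewrite yn; apply: nmin; apply/asboolP; exists x.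
pose near x := (wl x < N)%N%:R * phi x; pose far x := (N <= wl x)%N%:R * phi x.
have near0 x : 0 <= near x by rewrite mulr_ge0.
have far0 x : 0 <= far x by rewrite mulr_ge0.
have nfE (B : set G) : (\esum_(x in B) (phi x)%:E =
   \esum_(x in B) (near x)%:E + \esum_(x in B) (far x)%:E)%E.
  rewrite -esumD; try by move=> x _; rewrite lee_fin.
  apply: eq_esum => x _; rewrite -EFinD /near /far ltnNge; congr _%:E.
  by case: (N <= wl x)%N; rewrite ?mul1r ?mul0r ?addr0 ?add0r.
have [F /andP[F0 _] FE] := esum_fin [set x | (N <= wl x)%N] phiD.
have Fk : F <= kappa.
  rewrite -lee_fin -FE; apply: le_trans (admissible_tail phiA (ltn0Sn _)) _.
  by rewrite lee_fin.
have farE (B : set G) : (forall x, (wl y <= wl x)%N -> B x) ->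
    \esum_(x in B) (far x)%:E = F%:E.
  move=> yB; rewrite -FE [LHS]esum_mkcond [RHS]esum_mkcond; apply: eq_esum => x _.
  rewrite /far; case: ifPn => [xB|/negP xB]; case: ifPn => [/set_mem/= xN|/negP xN].
  - by rewrite xN mul1r.
  - by rewrite (_ : (N <= wl x)%N = false) ?mul0r//; apply/negP => h; apply: xN; exact: mem_set.
  - have [->//|px] := eqVneq (phi x) 0.
    by case: xB; apply: mem_set; apply: yB; exact: ymin.
  - by [].
pose phi1 x := near x + F * dirac_pair y x.
have phi10 x : 0 <= phi1 x by rewrite addr_ge0// mulr_ge0// dirac_pair_ge0.
have phi1E (B : set G) : (y^-1%g \in B) = (y \in B) -> (\esum_(x in B) (phi1 x)%:E =
   \esum_(x in B) (near x)%:E + (F * (y \in B)%:R)%:E)%E.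
  move=> yB; rewrite EFinM -(esum_dirac_pair yB) -esumZl//; last exact: dirac_pair_ge0.
  rewrite -esumD; first by apply: eq_esum => x _; rewrite -EFinD.
    by move=> x _; rewrite lee_fin.
  by move=> x _; rewrite lee_fin mulr_ge0// dirac_pair_ge0.
exists phi1, (word_ball S (wl y)); split; last first.
  move=> x; rewrite word_ballP// -ltnNge => yx.
  rewrite /phi1 /near dirac_pair_eq0 ?gtn_eqF// mulr0 addr0.
  by rewrite ltnNge (leq_trans yN (ltnW yx)) mul0r.
split.
- split=> [//|x|].
    by rewrite /phi1 /near dirac_pair_sym word_lengthV// psym.
  by rewrite phi1E ?in_setT// mulr1 -(farE setT)// -nfE.
- move=> x; rewrite /phi1 /near; case: ltnP => xN.
    by rewrite mul1r dirac_pair_eq0 ?mulr0 ?addr0// ltn_eqF// (leq_trans xN).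
  rewrite mul0r add0r; apply: le_trans Fk.
  by rewrite ler_piMr// dirac_pair_le1.
move=> s s0; apply: le_trans (pM s s0); apply: lee_wpmul2l; first by rewrite lee_fin ltW.
rewrite phi1E ?mem_rho_ball// nfE leeD2l//.
have [/set_mem/= ys|_] := boolP (y \in above s); last first.
  by rewrite mulr0; apply: esum_ge0 => x _; rewrite lee_fin.
rewrite mulr1 farE// => x yx /=; apply: lt_le_trans ys _; by rewrite rho_le.
Qed.

(** Mass at 1 only counts in the tails that contain everything, so some can be added. *)
Lemma admissible_lazy phi (X : {fset G}) : admissible phi ->
  (forall x, x \notin X -> phi x = 0) ->
  exists phi1 (X1 : {fset G}), [/\ admissible phi1, 0 < phi1 1%g &
    forall x, x \notin X1 -> phi1 x = 0].
Proof.
move=> phiA phiX; have [phiD pk pM] := phiA; have [p0 psym p1] := phiD.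
have [p10|p1n] := eqVneq (phi 1%g) 0; last first.
  by exists phi, X; split => //; rewrite lt_neqAle eq_sym p1n p0.
have k0 := admissible_kappa_gt0 phiA.
pose t := Num.min kappa 2^-1.
have t0 : 0 < t by rewrite lt_min k0 invr_gt0 ltr0n.
have tk : t <= kappa by rewrite ge_min lexx.
have t2 : t <= 2^-1 by rewrite ge_min lexx orbT.
pose phi1 x := (1 - t) * phi x + t * (x == 1%g)%:R.
have t10 : 0 <= 1 - t by lra.
have phi1E (B : set G) : (\esum_(x in B) (phi1 x)%:E =
   (1 - t)%:E * (\esum_(x in B) (phi x)%:E) + (t * (1%g \in B)%:R)%:E)%E.
  rewrite EFinM -esum_dirac -!esumZl ?(ltW t0)// -esumD.
  - by apply: eq_esum => x _; rewrite -EFinD.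
  - by move=> x _; rewrite lee_fin mulr_ge0.
  - by move=> x _; rewrite lee_fin mulr_ge0// ltW.
exists phi1, (1%g |` X)%fset; split.
- split.
  + split=> [x|x|].
    * by rewrite addr_ge0 ?mulr_ge0// ltW.
    * by rewrite /phi1 psym invg_eq1.
    * by rewrite phi1E p1 in_setT mule1 mulr1 -EFinD subrK.
  + move=> x; rewrite /phi1; have [->|x1] := eqVneq x 1%g.
      by rewrite p10 mulr0 add0r mulr1.
    by rewrite mulr0 addr0; apply: le_trans (pk x); rewrite ler_piMl//; lra.
  + move=> s s0; have [s1|s1] := ltP s 1.
      have -> : (above s) = setT.
        by apply/seteqP; split => // x _ /=; apply: lt_le_trans (rho_ge1 x).
      rewrite phi1E p1 in_setT mule1 mulr1 -EFinD subrK mule1.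
      have := pM s s0; rewrite (_ : [set x | _] = setT) ?p1 ?mule1//.
      by apply/seteqP; split => // x _ /=; apply: lt_le_trans (rho_ge1 x).
    apply: le_trans (pM s s0); apply: lee_wpmul2l; first by rewrite lee_fin ltW.
    rewrite phi1E memNset ?mulr0 ?adde0; last first.
      by rewrite /= /rho_pow word_length1 addr0 powR1; apply/negP; rewrite -leNgt.
    have [m /andP[m0 _] ->] := esum_fin (above s) phiD.
    by rewrite -EFinM lee_fin ler_piMl//; lra.
- by rewrite /phi1 p10 eqxx mulr0 add0r mulr1.
- move=> x; rewrite !inE negb_or => /andP[/negPf x1 /phiX px].
  by rewrite /phi1 x1 px !mulr0 addr0.
Qed.

(** The mass [eps * (1 - psi 1)] is taken from the longest elements in the support of
[phi] and redistributed as [psi] does, farther away. At the scales that [phi] does not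
reach, only the part coming from [psi] counts. *)
Lemma admissible_perturb phi psi (eps : R) (n : nat) y :
  admissible phi -> (forall x, phi x != 0 -> (wl x <= wl y)%N) ->
  sym_density psi -> (forall x, x != 1%g -> psi x != 0 -> (wl y < wl x <= n)%N) ->
  0 <= eps -> eps <= kappa -> eps <= phi y -> eps <= phi 1%g / 2 ->
  eps * (1 + n%:R) `^ alpha <= M ->
  exists phi1, [/\ admissible phi1, phi 1%g / 2 <= phi1 1%g,
    forall z, z != 1%g -> eps * psi z <= phi1 z &
    forall x, phi x = 0 -> psi x = 0 -> phi1 x = 0].
Proof.
move=> phiA phiy psiD psiy e0 ek ey e1 eM.
have [phiD pk pM] := phiA; have [p0 psym p1] := phiD.
have [q0 qsym q1] := psiD; have M1 := admissible_M_ge1 phiA.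
have psi11 : 0 <= psi 1%g <= 1 by rewrite -(conv_pow1 psiD) conv_pow_01.
pose e' := eps * (1 - psi 1%g).
have e'0 : 0 <= e' by rewrite mulr_ge0// subr_ge0; case/andP: psi11.
have e'e : e' <= eps by rewrite ler_piMr// gerBl; case/andP: psi11.
have dp0 x : 0 <= e' * dirac_pair y x by rewrite mulr_ge0// dirac_pair_ge0.
have dpe x : e' * dirac_pair y x <= eps.
  by apply: le_trans e'e; rewrite ler_piMr// dirac_pair_le1.
have dpphi x : e' * dirac_pair y x <= phi x.
  have [->|xy] := eqVneq x y; first exact: le_trans (dpe y) ey.
  have [->|xy'] := eqVneq x (y^-1)%g; first by rewrite psym; exact: le_trans (dpe _) ey.
  by rewrite /dirac_pair (negPf xy) (negPf xy') !mulr0 addr0 mulr0.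
pose psi0 x := (x != 1%g)%:R * psi x.
have psi00 x : 0 <= psi0 x by rewrite mulr_ge0.
have psi0y x : psi0 x != 0 -> (wl y < wl x <= n)%N.
  rewrite /psi0; have [->|x1] := eqVneq x 1%g; first by rewrite mul0r eqxx.
  by rewrite mul1r; exact: psiy.
have phi0 x : (wl y < wl x)%N -> phi x = 0.
  by move=> yx; apply/eqP; apply: contraLR yx => /phiy; rewrite -leqNgt.
have psi0le1 x : psi0 x <= 1.
  rewrite /psi0 -[psi x](conv_pow1 psiD); have /andP[h0 h1] := conv_pow_01 psiD 1 x.
  by apply: le_trans h1; rewrite ler_piMl// lern1; case: (_ != _).
have epsi0 x : 0 <= eps * psi0 x by rewrite mulr_ge0.
have psi0T : (\esum_(x in [set: G]) (psi0 x)%:E = (1 - psi 1%g)%:E)%E.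
  have : (\esum_(x in [set: G]) (psi0 x)%:E + (psi 1%g)%:E = 1)%E.
    rewrite -q1 -[psi 1%g]mulr1 EFinM -(_ : \esum_(x in [set: G]) (x == 1%g)%:R%:E = 1%:E)%E; last first.
      by rewrite esum_dirac in_setT.
    rewrite -esumZl// -esumD; try by move=> x _; rewrite lee_fin ?mulr_ge0.
    apply: eq_esum => x _; rewrite -EFinD /psi0; congr _%:E.
    by have [->|_] := eqVneq x 1%g; rewrite ?mul0r ?mulr1 ?add0r ?mul1r ?mulr0 ?addr0.
  by move=> h; rewrite EFinB -h addeK.
pose phi1 x := phi x - e' * dirac_pair y x + eps * psi0 x.
have phi10 x : 0 <= phi1 x by rewrite addr_ge0// subr_ge0.
have phi1E (B : set G) : (y^-1%g \in B) = (y \in B) ->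
   (\esum_(x in B) (phi1 x)%:E + (e' * (y \in B)%:R)%:E =
   \esum_(x in B) (phi x)%:E + eps%:E * \esum_(x in B) (psi0 x)%:E)%E.
  move=> yB; rewrite EFinM -(esum_dirac_pair yB) -!esumZl//; last exact: dirac_pair_ge0.
  rewrite -!esumD; try by move=> x _; rewrite lee_fin.
  by apply: eq_esum => x _; rewrite -!EFinD /phi1; congr _%:E; ring.
exists phi1; split.
- split.
  + split=> // [x|].
      by rewrite /phi1 /psi0 psym dirac_pair_sym invg_eq1 qsym.
    have := phi1E setT; rewrite !in_setT mulr1 p1 psi0T => /(_ erefl).
    rewrite -EFinM -/e' => h.
    by move: (congr1 (fun z => z - e'%:E)%E h); rewrite !addeK.
  + move=> x; rewrite /phi1; have [->|ps] := eqVneq (psi0 x) 0.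
      by rewrite mulr0 addr0; apply: le_trans (pk x); rewrite gerBl.
    have /andP[yx _] := psi0y x ps.
    rewrite (phi0 x yx) sub0r; apply: le_trans ek.
    apply: (@le_trans _ _ (eps * psi0 x)); first by rewrite gerDr oppr_le0.
    by rewrite ler_piMr// psi0le1.
  + move=> s s0; have [/set_mem/= ys|/negP yns] := boolP (y \in above s).
      have E : (\esum_(x in above s) (psi0 x)%:E = (1 - psi 1%g)%:E)%E.
        rewrite -psi0T [LHS]esum_mkcond; apply: eq_esum => x _.
        case: ifPn => // /negP xs; have [->//|/psi0y/andP[yx _]] := eqVneq (psi0 x) 0.
        by case: xs; apply: mem_set; apply: lt_trans ys _; rewrite rho_lt.
      have := phi1E _ (mem_rho_ball s y).
      rewrite E (mem_set (ys : above s y)) mulr1 -EFinM -/e' => h.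
      move: (congr1 (fun z => z - e'%:E)%E h); rewrite !addeK// => ->.
      exact: pM.
    have E : (\esum_(x in above s) (phi x)%:E = 0)%E.
      apply: esum1 => x /= xs; have [->//|/phiy xy] := eqVneq (phi x) 0.
      by case: yns; apply: mem_set => /=; apply: lt_le_trans xs _; rewrite rho_le.
    have := phi1E _ (mem_rho_ball s y).
    rewrite E (memNset (_ : ~ above s y)); last by move=> ?; apply: yns; exact: mem_set.
    rewrite mulr0 adde0 add0e => ->.
    have [ns|sn] := leP ((1 + n%:R) `^ alpha) s.
      rewrite (esum1 (D := above s)) ?mule0 ?lee_fin; first by lra.
      move=> x /= xs; have [->//|/psi0y/andP[_ xn]] := eqVneq (psi0 x) 0.
      move: xs; rewrite ltNge => /negP[]; apply: le_trans ns.
      by rewrite ler_powR_base ?(ltW alpha0) ?addr_ge0// lerD2l ler_nat.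
    rewrite muleA -EFinM; apply: (@le_trans _ _ ((s * eps)%:E * 1)%E).
      apply: lee_wpmul2l; first by rewrite lee_fin mulr_ge0// ltW.
      apply: (@le_trans _ _ (\esum_(x in [set: G]) (psi0 x)%:E)).
        rewrite [leLHS]esum_mkcond; apply: le_esum => x _.
        by case: ifP => _; rewrite lee_fin.
      by rewrite psi0T lee_fin gerBl; case/andP: psi11.
    rewrite mule1 lee_fin; apply: le_trans eM; rewrite mulrC ler_wpM2l//; exact: ltW.
- rewrite /phi1 /psi0 eqxx mul0r mulr0 addr0; have := dpe 1%g; lra.
- move=> z z1; rewrite /phi1 /psi0 z1 mul1r.
  have [->|pz] := eqVneq (psi z) 0; first by rewrite mulr0 addr0 subr_ge0.
  have /andP[yz _] := psiy z z1 pz.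
  by rewrite dirac_pair_eq0 ?gtn_eqF// mulr0 subr0 lerDr.
- move=> x px qx; apply/eqP; rewrite eq_le phi10 andbT /phi1 px /psi0 qx !mulr0 addr0.
  by rewrite sub0r oppr_le0.
Qed.

End Spread.

(** * Densities adapted to a scale *)

Section Lower.
Variables (R : realType) (K G : groupType).

(** Distinct copies only meet at 1, so each element of [Y] other than 1 spoils at most one
of them. *)
Lemma copies_avoid (I : finType) (e : I -> K -> G) (rd : I -> G -> K)
    (A : {fset K}) (Y : {fset G}) : copies e rd ->
  exists (J : finType) (f : J -> I), [/\ (#|I| <= #|J| + #|` Y|)%N,
    copies (fun j => e (f j)) (fun j => rd (f j)) &
    forall j a, a \in A -> a != 1%g -> e (f j) a \notin Y].
Proof.
move=> [eM rdE]; pose bad i := has (fun a => (a != 1%g) && (e i a \in Y)) A.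
exists {i | ~~ bad i}, val; split.
- rewrite card_sig -(cardC bad) addnC leq_add//.
  have ex i : exists g, bad i -> exists2 a, a != 1%g & g = e i a /\ g \in Y.
    have [/hasP[a _ /andP[a1 aY]]|_] := boolP (bad i); last by exists 1%g.
    by exists (e i a) => _; exists a.
  have [g gP] := choice ex.
  have g_inj : {in bad &, injective g}.
    move=> i j /gP[a a1 [ga _]] /gP[b b1 [gb _]] gij; apply/eqP.
    apply: contra_neqT a1 => ij.
    have := rdE i i a 1%g; rewrite eqxx mulg1 -ga gij gb -[e j b]mulg1 rdE (negPf ij).
    by move/(congr1 (fun k => k * (rd i 1)^-1)%g); rewrite mulgK mulgV.
  rewrite cardE -(size_map g) -[X in (_ <= X)%N](size_map id) map_id.
  apply: uniq_leq_size.
    rewrite map_inj_in_uniq ?enum_uniq// => i j.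
    by rewrite !mem_enum; exact: g_inj.
  by move=> x /mapP[i]; rewrite mem_enum => /gP[a _ [_ gY]] ->.
- split=> [i k k'|i j k g]; first exact: eM.
  by rewrite rdE (inj_eq val_inj).
- move=> [i /= ib] a aA a1; apply: contra ib => eY; apply/hasP; exists a => //.
  by rewrite a1.
Qed.

(** The weight [eps] of order [r ^ - alpha] is the largest that the weak moment allows for
steps of length of order [r]. The copies that meet the support of the density at hand
are dropped, so that [eps * psi] can be added far from it. *)
Theorem return_upper (S : {fset G}) (alpha kappa M : R) (A : nat -> {fset K})
    (d : nat) (phi0 : G -> R) :
  sym_generating S -> 0 < alpha -> (0 < d)%N ->
  (forall r, (0 < r)%N -> [/\ 1%g \in A r, fsymmetric (A r) & (1 < #|` A r|)%N]) ->
  has_copies A (fun r => r ^ d)%N G -> admissible S alpha kappa M phi0 ->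
  exists c : R, exists2 r0 : nat, 0 < c & (0 < r0)%N /\
   forall r n, (r0 <= r)%N -> exists2 phi, admissible S alpha kappa M phi &
     conv_pow phi n.*2 1%g <= expR (- (c * (r%:R ^+ d * ln #|` A r|%:R))) \/
     conv_pow phi n.*2 1%g <= expR (- (c * (n%:R * r%:R `^ (- alpha)))).
Proof.
move=> hS a0 d0 AP copiesG phi0A.
have [phi01 [X0 [phi01A X0P]]] := admissible_truncate hS a0 phi0A.
have [phi [X [phiA phi1 XP]]] := admissible_lazy a0 phi01A X0P.
have [phiD _ _] := phiA; have [p0 psym p1] := phiD.
have k0 := admissible_kappa_gt0 phiA; have M1 := admissible_M_ge1 a0 phiA.
pose wl := word_length S.
have [y y0 ymax] : exists2 y, phi y != 0 & forall x, phi x != 0 -> (wl x <= wl y)%N.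
  pose P n := `[< exists2 y, phi y != 0 & wl y = n >].
  have exP : exists n, P n by exists (wl 1%g); apply/asboolP; exists 1%g; rewrite ?gt_eqF.
  have ubP n : P n -> (n <= \max_(x <- X) wl x)%N.
    move=> /asboolP[x px <-]; apply: leq_bigmax_seq => //.
    by apply: contra_neqT px => /XP.
  case: (ex_maxnP exP ubP) => n /asboolP[y py yn] nmax; exists y => // x px.
  by rewrite yn; apply: nmax; apply/asboolP; exists x.
have py : 0 < phi y by rewrite lt_neqAle eq_sym y0 p0.
have [C CP] := copiesG wl (And3 (word_length1 S) (word_lengthM hS) (word_lengthV hS)).
pose C1 : R := 1 + C%:R; have C10 : 0 < C1 by rewrite /C1 ltr_pwDl.
pose e1 := Num.min (Num.min (phi 1%g / 2) (phi y)) (Num.min kappa (M / C1 `^ alpha)).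
have e10 : 0 < e1.
  by rewrite !lt_min py k0 divr_gt0//= divr_gt0 ?powR_gt0//; lra.
pose theta : R := expR (- 32^-1).
have t1 : theta < 1 by rewrite /theta -[ltRHS]expR0 ltr_expR; lra.
pose c := Num.min 16^-1 (2 * (phi 1%g / 2) * e1 * (1 - theta)).
have c0 : 0 < c.
  by rewrite lt_min invr_gt0 ltr0n/= !mulr_gt0// ?invr_gt0// subr_gt0.
pose Y := word_ball S (wl y).
exists c; exists (2 * #|` Y|).+1 => //; split=> // r n r0r.
have r0 : (0 < r)%N by exact: leq_trans r0r.
have rR : 0 < r%:R :> R by rewrite ltr0n.
have [A1 AV A2] := AP r r0.
have [I [e [rd [IN eK eC]]]] := CP r r0.
have [J [f [IJ fK fY]]] := copies_avoid (A r) Y eK.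
have rd_r : (r <= r ^ d)%N by rewrite -{1}[r]expn1 leq_pexp2l.
have half (a b c' s : nat) : (a <= b + c' -> 2 * c' < s -> s <= a -> a <= 2 * b)%N.
  by clear; lia.
have J2 : (r ^ d <= 2 * #|J|)%N by rewrite IN in IJ; exact: half IJ r0r rd_r.
have J0 : (0 < #|J|)%N.
  by have := leq_trans r0 (leq_trans rd_r J2); rewrite muln_gt0 => /andP[].
have [j0 _] : exists j, j \in J by apply/card_gt0P.
pose e' j := e (f j); pose psi := refresh R e' (A r).
have psiD : sym_density psi by exact: (refresh_density R fK A1 AV j0).
pose eps := e1 * r%:R `^ (- alpha).
have ra1 : r%:R `^ (- alpha) <= 1 :> R.
  rewrite powRN invf_le1 ?powR_gt0//; apply: le_trans (_ : 1 `^ alpha <= _).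
    by rewrite powR1.
  by rewrite ler_powR_base ?(ltW a0)// ler1n.
have eps0 : 0 <= eps by rewrite mulr_ge0 ?(ltW e10)// powR_ge0.
have epse : eps <= e1 by rewrite ler_piMr// ltW.
have psisupp x : x != 1%g -> psi x != 0 -> (wl y < wl x <= C * r)%N.
  move=> x1 px; have : x \in refresh_supp e' (A r).
    by apply: contra_neqT px => xZ; exact: refresh_eq0.
  move=> /imfset2P[j /= _ [a /= aA xE]]; move: x1; rewrite xE => x1.
  rewrite eC// andbT ltnNge -(word_ballP hS); apply: fY => //.
  by apply: contraNneq x1 => ->; apply/eqP; exact: (copies1 fK j).
have [phi' [phi'A phi'1 phi'psi phi'0]] : exists phi', [/\ admissible S alpha kappa M phi',
    phi 1%g / 2 <= phi' 1%g, forall z, z != 1%g -> eps * psi z <= phi' z &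
    forall x, phi x = 0 -> psi x = 0 -> phi' x = 0].
  apply: (@admissible_perturb R G S alpha kappa M hS a0 phi psi eps (C * r) y) => //.
  - by apply: le_trans epse _; rewrite !ge_min lexx !orbT.
  - by apply: le_trans epse _; rewrite !ge_min lexx !orbT.
  - by apply: le_trans epse _; rewrite !ge_min lexx.
  apply: (@le_trans _ _ (e1 * r%:R `^ (- alpha) * (C1 * r%:R) `^ alpha)).
    rewrite ler_wpM2l// ler_powR_base ?(ltW a0) ?addr_ge0//.
    by rewrite /C1 mulrDl mul1r natrM lerD2r ler1n.
  rewrite powRM ?(ltW C10)// powRN.
  rewrite (_ : _ * _ = e1 * C1 `^ alpha); last first.
    by field; rewrite gt_eqF// powR_gt0.
  by rewrite -ler_pdivlMr ?powR_gt0// !ge_min lexx !orbT.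
exists phi' => //; have [phi'D _ _] := phi'A.
have [k kpos psik] := @refresh_small_return R K G J e' _ (A r) j0 fK A1 AV A2.
have suppX x : x \notin (X `|` refresh_supp e' (A r))%fset -> phi' x = 0.
  rewrite inE negb_or => /andP[/XP px /(refresh_eq0 R) qx]; exact: phi'0.
have supp_psi x : x \notin refresh_supp e' (A r) -> psi x = 0.
  by move=> xZ; exact: refresh_eq0.
have del0 : 0 <= phi 1%g / 2 by rewrite divr_ge0// ltW.
have t01 : 0 <= theta <= 1 by rewrite expR_ge0 ltW.
have [h|h] := return_decay phi'D suppX psiD supp_psi del0 eps0 phi'1 phi'psi n
    kpos t01 (expR_gt0 _) psik; [left|right]; apply: le_trans h _; rewrite ler_expR lerN2.
  apply: (@le_trans _ _ (16^-1 * (r%:R ^+ d * ln #|` A r|%:R))).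
    by rewrite ler_wpM2r ?ge_min ?lexx// mulr_ge0 ?exprn_ge0// ln_ge0// ler1n ltnW.
  have lA : 0 <= ln #|` A r|%:R :> R by rewrite ln_ge0// ler1n ltnW.
  have J2R : r%:R ^+ d <= 2 * #|J|%:R :> R by rewrite -natrX -natrM ler_nat.
  nra.
apply: (@le_trans _ _ (2 * (phi 1%g / 2) * e1 * (1 - theta) * (n%:R * r%:R `^ (- alpha)))).
  by rewrite ler_wpM2r ?mulr_ge0 ?powR_ge0// ge_min lexx orbT.
by rewrite /eps le_eqVlt; apply/orP; left; apply/eqP; ring.
Qed.

End Lower.

(** * Asymptotics *)

Section Asymptotics.
Variable R : realType.

Lemma spread_class_admissible (G : groupType) (S Omega : {fset G}) (alpha kappa : R)
    (phi : G -> R) :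
  spread_class (rho_pow S alpha) Omega kappa phi <->
  admissible S alpha kappa
    (kappa * sup (rho_pow S alpha @` [set` fset_mul Omega Omega])) phi.
Proof.
split=> [[phiD pk pM]|[phiD pk pM]].
  split=> // [x|s s0].
    rewrite -lee_fin; apply: le_trans pk; apply: ereal_sup_ubound; exists x => //.
    by rewrite ger0_norm// density_ge0.
  by apply: le_trans pM; apply: ereal_sup_ubound; exists s.
split=> //.
  apply: ge_ereal_sup => _ [x _ <-]; rewrite lee_fin ger0_norm//.
  exact: density_ge0.
by apply: ge_ereal_sup => _ [s s0 <-]; exact: pM.
Qed.

(** A quantity bounded by the scale-wise estimates is of the order of their common
value at the scale that balances them. *)
Lemma simeq_of_scales (u : nat -> R) (g : R -> R) (h : nat -> R) (alpha : R)
    (r0 : nat) (C c B b T : R) :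
  0 < alpha -> 0 < C -> 0 < c -> 0 < B -> 0 < b ->
  (forall r n, (r0 <= r)%N -> (0 < n)%N -> u n <= C * (n%:R * r%:R `^ (- alpha) + h r)) ->
  (forall r n, (r0 <= r)%N -> (0 < n)%N ->
     c * Num.min (h r) (n%:R * r%:R `^ (- alpha)) <= u n) ->
  (forall t, T < t -> exists2 r, (r0 <= r)%N &
     [/\ h r <= B * g t, t * r%:R `^ (- alpha) <= B * g t,
         b * g t <= h r & b * g t <= t * r%:R `^ (- alpha)]) ->
  simeq (on_reals u) g.
Proof.
move=> a0 C0 c0 B0 b0 uU uL gP.
exists ((2 * C * B)^-1), 1, (2 / (c * b)), 1; split.
  by rewrite invr_gt0 divr_gt0 ?mulr_gt0.
exists (Num.max 1 T); split; first exact: num_real.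
move=> t; rewrite gt_max => /andP[t1 Tt]; rewrite !mul1r /on_reals.
have [r rr [hB tB bh bt]] := gP t Tt.
set n := Num.truncn t.
have n0 : (0 < n)%N by rewrite truncn_gt0 ltW.
have nt : n%:R <= t by rewrite truncn_le; lra.
have n1 : 1 <= n%:R :> R by rewrite ler1n.
have tn : t <= 2 * n%:R.
  by apply: le_trans (ltW (truncnS_gt t)) _; rewrite -natr1 -/n; lra.
have ra : 0 <= r%:R `^ (- alpha) :> R by exact: powR_ge0.
apply/andP; split.
  rewrite ler_pdivrMl ?mulr_gt0//; apply: le_trans (uU r n rr n0) _.
  have := ler_wpM2r ra nt; nra.
rewrite mulrC mulrA ler_pdivlMr ?mulr_gt0//.
have := uL r n rr n0; have := ler_wpM2r ra tn => h1 h2.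
have h3 : b * g t / 2 <= Num.min (h r) (n%:R * r%:R `^ (- alpha)).
  have g0 : 0 <= t * r%:R `^ (- alpha) by rewrite mulr_ge0//; lra.
  have : 0 <= B * g t by exact: le_trans tB.
  rewrite pmulr_rge0// => gt0.
  have bg0 : 0 <= b * g t by rewrite mulr_ge0// ltW.
  by rewrite le_min; apply/andP; split; lra.
have := ler_wpM2l (ltW c0) h3; nra.
Qed.

End Asymptotics.

Section Scales.
Variable R : realType.

Lemma powR_expR (y s : R) : 0 < y -> y `^ s = expR (s * ln y).
Proof. by move=> y0; rewrite -ln_powR lnK// posrE powR_gt0. Qed.

(** At the scale [x] with [x ^ (d + alpha) = t / Lam t], the two terms agree. *)
Lemma balanced_scale (d r0 : nat) (alpha a b : R) (lam : nat -> R) (Lam : R -> R) (t : R) :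
  let p := d%:R + alpha in
  let x := (t / Lam t) `^ p^-1 in
  let g := t `^ (d%:R / p) * Lam t `^ (alpha / p) in
  let B := Num.max (2 ^+ d * b) 1 in
  let c := Num.min a (2 `^ (- alpha)) in
  0 < alpha -> 0 < t -> 0 < Lam t -> 1 <= x -> r0%:R <= x -> 0 < a ->
  (forall r, x <= r%:R <= 2 * x -> a * Lam t <= lam r <= b * Lam t) ->
  exists2 r, (r0 <= r)%N &
    [/\ r%:R ^+ d * lam r <= B * g, t * r%:R `^ (- alpha) <= B * g,
        c * g <= r%:R ^+ d * lam r & c * g <= t * r%:R `^ (- alpha)].
Proof.
move=> p x g B c al0 t0 L0 x1 r0x a0 lamP.
have x0 : 0 < x by lra.
have p0 : 0 < p by rewrite /p ltr_wpDl.
have tL0 : 0 < t / Lam t by rewrite divr_gt0.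
have lnx : ln x = (ln t - ln (Lam t)) / p by rewrite /x ln_powR ln_div ?posrE// mulrC.
have gE : g = expR (d%:R / p * ln t + alpha / p * ln (Lam t)).
  by rewrite /g !powR_expR// expRD.
have g0 : 0 < g by rewrite gE expR_gt0.
have xd : x ^+ d * Lam t = g.
  rewrite -powR_mulrn ?(ltW x0)// powR_expR// -[X in _ * X]lnK ?posrE// -expRD lnx gE.
  by congr expR; rewrite /p; field; rewrite gt_eqF.
have xa : t * x `^ (- alpha) = g.
  rewrite powR_expR// -[X in X * _]lnK ?posrE// -expRD lnx gE.
  by congr expR; rewrite /p; field; rewrite gt_eqF.
pose r := (Num.truncn x).+1.
have xr : x <= r%:R by exact: ltW (truncnS_gt x).
have r2 : r%:R <= 2 * x.
  have : (Num.truncn x)%:R <= x by rewrite truncn_le ltW.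
  by rewrite /r -natr1; lra.
have /andP[la lb] := lamP r (introT andP (conj xr r2)).
have rd1 : x ^+ d <= r%:R ^+ d by rewrite lerXn2r ?nnegrE// ltW.
have rd2 : r%:R ^+ d <= 2 ^+ d * x ^+ d by rewrite -exprMn lerXn2r ?nnegrE// mulr_ge0// ltW.
have xd0 : 0 < x ^+ d by rewrite exprn_gt0.
have aL : 0 < a * Lam t by rewrite mulr_gt0.
have rR : 0 < r%:R :> R by rewrite ltr0n.
have ra1 : r%:R `^ (- alpha) <= x `^ (- alpha).
  rewrite !powRN lef_pV2 ?posrE ?powR_gt0//.
  by rewrite ler_powR_base ?(ltW al0)// ltW.
have ra2 : 2 `^ (- alpha) * x `^ (- alpha) <= r%:R `^ (- alpha).
  rewrite -powRM ?(ltW x0)// !powRN lef_pV2 ?posrE ?powR_gt0 ?mulr_gt0//.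
  by rewrite ler_powR_base ?(ltW al0).
exists r; first by rewrite -(ler_nat R); exact: le_trans xr.
split.
- apply: (@le_trans _ _ (2 ^+ d * b * g)).
    rewrite (_ : 2 ^+ d * b * g = 2 ^+ d * x ^+ d * (b * Lam t)); last by rewrite -xd; ring.
    by apply: ler_pM => //; apply: le_trans la; exact: ltW.
  by rewrite ler_wpM2r ?(ltW g0)// le_max lexx.
- apply: (@le_trans _ _ (1 * g)); first by rewrite mul1r -xa ler_wpM2l// ltW.
  by rewrite ler_wpM2r ?(ltW g0)// le_max lexx orbT.
- apply: (@le_trans _ _ (a * g)); first by rewrite ler_wpM2r ?(ltW g0)// ge_min lexx.
  rewrite -xd mulrCA; apply: ler_pM => //; exact: ltW.
- apply: (@le_trans _ _ (2 `^ (- alpha) * g)).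
    by rewrite ler_wpM2r ?(ltW g0)// ge_min lexx orbT.
  by rewrite -xa mulrCA ler_wpM2l// ltW.
Qed.

Lemma large_powR (alpha y : R) : 0 < alpha -> exists T : R, forall t, T < t -> y <= t `^ alpha.
Proof.
move=> a0; exists (Num.max 0 (Num.max 0 y `^ alpha^-1)) => t.
rewrite gt_max => /andP[t0 yt]; apply: (@le_trans _ _ (Num.max 0 y)).
  by rewrite le_max lexx orbT.
have -> : Num.max 0 y = (Num.max 0 y `^ alpha^-1) `^ alpha.
  by rewrite -powRrM mulVf ?gt_eqF// powRr1// le_max lexx.
by rewrite ler_powR_base ?(ltW a0) ?powR_ge0// ltW.
Qed.

Lemma ln_le_sqrt (t : R) : 0 < t -> ln t <= 2 * t `^ 2^-1.
Proof.
move=> t0; have s0 : 0 < t `^ 2^-1 by rewrite powR_gt0.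
have := ln_sublinear s0; rewrite ln_powR => h.
rewrite -ler_pdivrMl//; exact: ltW.
Qed.

(** Up to constants, [ln] takes the same value at [t] and at the balanced scale, which
lies between two powers of [t]. *)
Lemma ln_balanced (p : R) (r0 : nat) : 1 <= p -> exists T : R, forall t, T < t ->
  [/\ 0 < t, 0 < ln t, 1 <= (t / ln t) `^ p^-1, r0%:R <= (t / ln t) `^ p^-1 &
   forall r, (t / ln t) `^ p^-1 <= r%:R <= 2 * (t / ln t) `^ p^-1 ->
     (4 * p)^-1 * ln t <= ln r.+1%:R <= 2 * ln t].
Proof.
move=> p1; have p0 : 0 < p by lra.
have pV0 : 0 < p^-1 by rewrite invr_gt0.
have q0 : 0 < 4^-1 :> R by rewrite invr_gt0.
have [T1 T1P] := large_powR r0%:R (mulr_gt0 q0 pV0).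
have [T2 T2P] := large_powR 2 q0.
exists (Num.max (Num.max T1 T2) 16) => t; rewrite !gt_max -andbA => /and3P[tT1 tT2 t16].
have t0 : 0 < t by lra.
have e1 : expR 1 <= 4 :> R.
  rewrite (_ : 1 = 2^-1 + 2^-1); last by field.
  rewrite expRD; have h : expR 2^-1 <= 2 :> R.
    rewrite -[2^-1]opprK expRN -[leRHS]invrK lef_pV2 ?posrE ?expR_gt0//.
    by apply: le_trans (expR_ge1Dx _); lra.
  by have := expR_ge0 (2^-1 : R); nra.
have l1 : 1 <= ln t by rewrite -ler_expR lnK ?posrE//; lra.
have l0 : 0 < ln t by lra.
have q2 := T2P t tT2.
have tq : t `^ 2^-1 = t `^ 4^-1 * t `^ 4^-1.
  by rewrite -powRDp//; congr (_ `^ _); field.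
have th : t = t `^ 2^-1 * t `^ 2^-1.
  by rewrite -powRDp// (_ : 2^-1 + 2^-1 = 1) ?powRr1//; [exact: ltW|field].
have lnt := ln_le_sqrt t0.
have tl : t `^ 4^-1 <= t / ln t.
  rewrite ler_pdivlMr//; apply: le_trans (ler_wpM2l (powR_ge0 _ _) lnt) _.
  rewrite [leRHS]th tq; have := powR_ge0 t 4^-1; nra.
have tlt : t / ln t <= t by rewrite ler_pdivrMr// ler_peMr// ltW.
set x := (t / ln t) `^ p^-1.
have xl : t `^ (4^-1 * p^-1) <= x.
  by rewrite powRrM /x ler_powR_base ?(ltW pV0)// powR_ge0.
have tl1 : 1 <= t / ln t by lra.
have xt : x <= t.
  apply: le_trans tlt; apply: (@le_trans _ _ ((t / ln t) `^ 1)); last by rewrite powRr1//; lra.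
  by apply: ler_powR => //; rewrite invf_le1.
have x1 : 1 <= x.
  by have : 1 `^ p^-1 <= x; [rewrite /x ler_powR_base ?(ltW pV0)|rewrite powR1].
split=> //; first by apply: le_trans xl; exact: T1P.
move=> r /andP[xr rx]; apply/andP; split.
  have -> : (4 * p)^-1 * ln t = ln (t `^ (4^-1 * p^-1)) by rewrite ln_powR invfM.
  rewrite ler_ln ?posrE ?powR_gt0 ?ltr0n//; apply: le_trans xl _.
  by apply: le_trans xr _; rewrite ler_nat.
have -> : 2 * ln t = ln (t ^+ 2) by rewrite lnXn// mulr_natl.
rewrite ler_ln ?posrE ?exprn_gt0 ?ltr0n// -natr1; nra.
Qed.

End Scales.

(** * The order of magnitude of the infimum *)

Section MinusLog.
Variables (R : realType) (G : groupType) (S Omega : {fset G}) (alpha kappa : R).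
Hypothesis hS : sym_generating S.
Hypothesis alpha02 : 0 < alpha < 2.
Hypothesis class_neq0 : spread_class (rho_pow S alpha) Omega kappa !=set0.

Local Notation Phi n := (Phi_tilde (rho_pow S alpha) Omega kappa n).
Let M := kappa * sup (rho_pow S alpha @` [set` fset_mul Omega Omega]).

Lemma minus_log_Phi_le (V : nat -> R) : test_family G V ->
  exists C : R, exists2 r0 : nat, 0 < C & (0 < r0)%N /\
   forall r n, (r0 <= r)%N -> (0 < n)%N ->
     0 < Phi n /\ - ln (Phi n) <= C * (n%:R * r%:R `^ (- alpha)) + V r.
Proof.
move=> GV; have /andP[a0 _] := alpha02.
have [phi0 /spread_class_admissible phi0A] := class_neq0.
have M0 : 0 <= M by apply: le_trans (admissible_M_ge1 a0 phi0A).
have [C [r0 C0 [r00 H]]] := return_lower hS GV alpha02 M0.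
exists C; exists r0 => //; split => // r n rr n0.
have le : expR (- (C * (n%:R * r%:R `^ (- alpha)) + V r)) <= Phi n.
  apply: lb_le_inf; first by exists (conv_pow phi0 n.*2 1%g); exists phi0 => //; exact/spread_class_admissible.
  move=> _ [phi /spread_class_admissible phiA <-]; apply: H => //.
    by case: phiA.
  exact: (admissible_tail a0 phiA).
have P0 : 0 < Phi n by apply: lt_le_trans le; exact: expR_gt0.
by split => //; rewrite lerNl -ler_expR lnK// posrE.
Qed.

Lemma minus_log_Phi_ge (K : groupType) (A : nat -> {fset K}) (d : nat) :
  (forall n, (0 < n)%N -> 0 < Phi n) -> (0 < d)%N ->
  (forall r, (0 < r)%N -> [/\ 1%g \in A r, fsymmetric (A r) & (1 < #|` A r|)%N]) ->
  has_copies A (fun r => r ^ d)%N G ->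
  exists c : R, exists2 r0 : nat, 0 < c & (0 < r0)%N /\
   forall r n, (r0 <= r)%N -> (0 < n)%N ->
     c * Num.min (r%:R ^+ d * ln #|` A r|%:R) (n%:R * r%:R `^ (- alpha)) <= - ln (Phi n).
Proof.
move=> Phi0 d0 AP cop; have /andP[a0 _] := alpha02.
have [phi0 /spread_class_admissible phi0A] := class_neq0.
have [c [r0 c0 [r00 H]]] := return_upper hS a0 d0 AP cop phi0A.
exists c; exists r0 => //; split => // r n rr n0.
have [phi phiA dec] := H r n rr.
have le : Phi n <= conv_pow phi n.*2 1%g.
  apply: ge_inf; last by exists phi => //; exact/spread_class_admissible.
  exists 0 => _ [psi /spread_class_admissible [psiD _ _] <-].
  exact: conv_pow_ge0.
rewrite lerNr -ler_expR lnK ?posrE ?Phi0//; apply: le_trans le _.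
by case: dec => h; apply: le_trans h _; rewrite ler_expR lerN2 ler_wpM2l ?(ltW c0)//
  ge_min lexx ?orbT.
Qed.

(** The two bounds at every scale, with [lam r] of the order of the logarithm of the
number of elements of [K] within reach at scale [r]. *)
Lemma simeq_minus_log_Phi (K : groupType) (A : nat -> {fset K}) (d : nat)
    (lam : nat -> R) (b c : R) (g : R -> R) (Lam : R -> R) (a' b' : R) :
  0 < b -> 0 < c -> (0 < d)%N ->
  test_family G (fun r => b * (r%:R ^+ d * lam r)) ->
  (forall r, (0 < r)%N -> [/\ 1%g \in A r, fsymmetric (A r) & (1 < #|` A r|)%N]) ->
  has_copies A (fun r => r ^ d)%N G ->
  (forall r, (0 < r)%N -> 0 <= lam r /\ c * lam r <= ln #|` A r|%:R) ->
  0 < a' ->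
  (forall r0 : nat, exists T : R, forall t, T < t ->
    [/\ 0 < t, 0 < Lam t, 1 <= (t / Lam t) `^ (d%:R + alpha)^-1,
      r0%:R <= (t / Lam t) `^ (d%:R + alpha)^-1 &
      forall r, (t / Lam t) `^ (d%:R + alpha)^-1 <= r%:R <=
          2 * (t / Lam t) `^ (d%:R + alpha)^-1 ->
        a' * Lam t <= lam r <= b' * Lam t]) ->
  simeq (on_reals (fun n => - ln (Phi n)))
    (fun t => t `^ (d%:R / (d%:R + alpha)) * Lam t `^ (alpha / (d%:R + alpha))).
Proof.
move=> b0 c0 d0 GV AP cop lamA a'0 LamP; have /andP[a0 _] := alpha02.
have [C [r1 C0 [r10 HC]]] := minus_log_Phi_le GV.
have Phi0 n : (0 < n)%N -> 0 < Phi n by move=> n0; case: (HC r1 n).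
have [c' [r2 c'0 [r20 Hc]]] := minus_log_Phi_ge Phi0 d0 AP cop.
have [T TP] := LamP (maxn r1 r2).
pose h r := r%:R ^+ d * lam r.
pose B := Num.max (2 ^+ d * b') 1; pose bb := Num.min a' (2 `^ (- alpha)).
have B0 : 0 < B by rewrite lt_max ltr01 orbT.
have bb0 : 0 < bb by rewrite lt_min a'0 powR_gt0.
pose c1 := Num.min c 1; have c10 : 0 < c1 by rewrite lt_min c0 ltr01.
apply: (@simeq_of_scales R _ _ h alpha (maxn r1 r2) (Num.max C b) (c' * c1) B bb T) => //.
- by rewrite lt_max C0.
- by rewrite mulr_gt0.
- move=> r n; rewrite geq_max => /andP[rr1 rr2] n0.
  have [_ hC] := HC r n rr1 n0; apply: le_trans hC _; rewrite mulrDr lerD//.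
    by rewrite ler_wpM2r ?mulr_ge0 ?powR_ge0// le_max lexx.
  have [l0 _] := lamA r (leq_trans r10 rr1).
  by rewrite ler_wpM2r ?mulr_ge0 ?exprn_ge0// le_max lexx orbT.
- move=> r n; rewrite geq_max => /andP[rr1 rr2] n0.
  apply: le_trans (Hc r n rr2 n0); rewrite -mulrA ler_wpM2l ?(ltW c'0)//.
  have [l0 lA] := lamA r (leq_trans r10 rr1).
  have h0 : 0 <= h r by rewrite mulr_ge0// exprn_ge0.
  have na : 0 <= n%:R * r%:R `^ (- alpha) :> R by rewrite mulr_ge0// powR_ge0.
  rewrite le_min; apply/andP; split.
    apply: (@le_trans _ _ (c * h r)).
      by apply: ler_pM; rewrite ?(ltW c10) ?le_min ?h0 ?na// ge_min lexx.
    by rewrite /h mulrCA ler_wpM2l ?exprn_ge0.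
  apply: (@le_trans _ _ (1 * (n%:R * r%:R `^ (- alpha)))); last by rewrite mul1r.
  by apply: ler_pM; rewrite ?(ltW c10) ?le_min ?h0 ?na// ge_min lexx orbT.
- move=> t /TP[t0 L0 x1 xr lamP].
  exact: (balanced_scale (b := b') a0 t0 L0 x1 xr a'0 lamP).
Qed.

End MinusLog.

Theorem theorem1p7 (R : realType) (alpha : R) (ds : seq nat) (K : groupType)
    (S Omega : {fset iter_wreath K ds}) (kappa : R)
    (halpha : 0 < alpha < 2)
    (hr : (0 < size ds)%N)
    (hds : forall d, d \in ds -> (1 <= d)%N)
    (hK : finitely_generated K)
    (hS : sym_generating S)
    (hOmega : 1%g \in Omega /\ fsymmetric Omega)
    (hkappa : spread_class (rho_pow S alpha) Omega kappa !=set0) :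
  let d : R := (\sum_(i <- ds) i)%N%:R in
  let minus_log_Phi : nat -> R := fun n =>
    - ln (Phi_tilde (rho_pow S alpha) Omega kappa n) in
  (finite_set [set: K] -> (exists k : K, k != 1%g) ->
     simeq (on_reals minus_log_Phi) (fun t => t `^ (d / (d + alpha)))) /\
  (polynomial_growth K -> infinite_set [set: K] ->
     simeq (on_reals minus_log_Phi)
       (fun t => t `^ (d / (d + alpha)) * (ln t) `^ (alpha / (d + alpha)))).
Proof.
move=> d mlP; have /andP[a0 a2] := halpha.
pose D := (\sum_(i <- ds) i)%N.
have D0 : (0 < D)%N.
  case: ds hr hds @D {d S Omega hS hOmega hkappa mlP} => // e es _ es1 /=.
  by rewrite big_cons addn_gt0 es1// mem_head.
have D1 : 1 <= D%:R + alpha.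
  by have : 1 <= D%:R :> R by [rewrite ler1n]; lra.
have copD (A : nat -> {fset K}) : has_copies A (fun=> 1%N) K ->
    has_copies A (fun r => r ^ D)%N (iter_wreath K ds).
  move=> /(iter_wreath_has_copies (ds := ds)).
  by under eq_fun do rewrite mul1n.
split=> [finK [k0 k01]|polyK infK].
- pose A : {fset K} := fset_set [set: K].
  have AT x : x \in A by rewrite in_fset_set// in_setT.
  have A2 : (1 < #|` A|)%N.
    have := fsubset_leq_card (_ : [fset 1%g; k0] `<=` A)%fset.
    rewrite cardfs2 eq_sym k01; apply.
    by apply/fsubsetP.
  have lnA : 0 < ln #|` A|%:R :> R by rewrite ln_gt0// ltr1n.
  have V1 r : (0 < r)%N -> 1 <= 1 + ln #|` A|%:R :> R by rewrite lerDl ltW.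
  have KV : test_family K (fun=> 1 + ln #|` A|%:R : R).
    by apply: test_family_le (finite_test_family R finK) => r _; rewrite lerDr.
  (* the 1 added to the logarithm ensures [V1], also when [K] has two elements *)
  have [b b0 GV] := iter_wreath_test_family ds V1 KV.
  have cop : has_copies (fun=> A) (fun=> 1%N) K.
    apply: trivial_copies => l _; exists (\max_(x <- A) l x)%N => r x r0 xA.
    by apply: leq_trans (leq_bigmax_seq _ xA isT) _; rewrite leq_pmulr.
  have -> : (fun t : R => t `^ (d / (d + alpha))) =
      (fun t => t `^ (D%:R / (D%:R + alpha)) * (fun=> 1) t `^ (alpha / (D%:R + alpha))).
    by apply/funext => t; rewrite powR1 mulr1.
  apply: (@simeq_minus_log_Phi R _ S Omega alpha kappa hS halpha hkappa K (fun=> A) D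
    (fun=> 1) (b * (1 + ln #|` A|%:R)) (ln #|` A|%:R) _ (fun=> 1) 1 1) => //.
  + by rewrite mulr_gt0// ltr_wpDl// ltW.
  + by apply: test_family_le GV => r _; rewrite le_eqVlt; apply/orP; left; apply/eqP; ring.
  + by move=> r _; split=> // x _.
  + exact: (copD _ cop).
  + by move=> r _; rewrite mulr1.
  + move=> r0; have pV : 0 < (D%:R + alpha)^-1 by rewrite invr_gt0; lra.
    have [T TP] := large_powR (Num.max 1 r0%:R) pV.
    exists (Num.max T 0) => t; rewrite gt_max => /andP[tT t0]; rewrite divr1.
    have := TP t tT; rewrite ge_max => /andP[t1 tr]; split => // r _.
    by rewrite mulr1 lexx.
- have [c1 c10 KV0] := growth_test_family R polyK.
  have [SK hSK _] := polyK.
  have ln2 : 0 < ln 2 :> R by rewrite ln_gt0// ltr1n.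
  have lnr r : (0 < r)%N -> ln 2 <= ln r.+1%:R :> R.
    by move=> r0; rewrite ler_ln ?posrE ?ltr0n// ler_nat.
  pose e := c1 + (ln 2)^-1; have e0 : 0 < e by rewrite addr_gt0// invr_gt0.
  have V1 r : (0 < r)%N -> 1 <= e * ln r.+1%:R :> R.
    move=> r0; rewrite mulrDl; apply: (@le_trans _ _ ((ln 2)^-1 * ln r.+1%:R)).
      by rewrite ler_pdivlMl// mulr1 lnr.
    by rewrite lerDr mulr_ge0 ?(ltW c10)// (le_trans (ltW ln2))// lnr.
  have KV : test_family K (fun r => e * ln r.+1%:R).
    apply: test_family_le KV0 => r r0; rewrite ler_wpM2r// ?lerDl ?invr_ge0 ?(ltW ln2)//.
    by rewrite (le_trans (ltW ln2))// lnr.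
  have [b b0 GV] := iter_wreath_test_family ds V1 KV.
  have cop : has_copies (word_ball SK) (fun=> 1%N) K.
    apply: trivial_copies => l [l1 lM _]; have [C CP] := length_le_word_length hSK lM l1.
    exists C => r x r0; rewrite word_ballP// => xr.
    by apply: leq_trans (CP x) _; rewrite leq_mul2l xr orbT.
  have cardA r : (r < #|` word_ball SK r|)%N by exact: word_ball_card.
  apply: (@simeq_minus_log_Phi R _ S Omega alpha kappa hS halpha hkappa K (word_ball SK) D
    (fun r => ln r.+1%:R) (b * e) 1 _ (@ln R) (4 * (D%:R + alpha))^-1 2) => //.
  + by rewrite mulr_gt0.
  + by apply: test_family_le GV => r _; rewrite le_eqVlt; apply/orP; left; apply/eqP; ring.
  + move=> r r0; split.
    * by rewrite word_ballP// word_length1.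
    * by move=> x; rewrite !word_ballP// word_lengthV.
    * exact: leq_ltn_trans (cardA r).
  + exact: (copD _ cop).
  + move=> r r0; rewrite mul1r; split; first by rewrite (le_trans (ltW ln2))// lnr.
    by rewrite ler_ln ?posrE ?ltr0n ?(leq_trans _ (cardA r))// ler_nat.
  + by rewrite invr_gt0 mulr_gt0//; lra.
  + by move=> r0; exact: ln_balanced.
Qed.
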